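(* For the dueling teams problem with $n$ players, team size $k$, deterministic feedback and additive total orders, there exists an algorithm that finds a Condorcet winning team within $\mathcal{O}(kn\log(k)+k^5)$ duels.
   Context: Setting (deterministic dueling teams problem). $n,k$ are integers with $1\le k\le n/2$. Players are $[n]$; a team is a $k$-element subset of $[n]$. There is an unknown strict total order $\succ$ on all teams satisfying Consistency: for every two distinct players $a,b$, either $S\cup\{a\}\succ S\cup\{b\}$ for all $S\subseteq[n]\setminus\{a,b\}$ with $|S|=k-1$, or $S\cup\{b\}\succ S\cup\{a\}$ for all such $S$. The order $\succ$ is additive if there exist (unknown) real values $v(x)$, $x\in[n]$, such that for teams $A,B$, $A\succ B$ iff $\sum_{a\in A}v(a)>\sum_{b\in B}v(b)$. In each round the learner (algorithm) adaptively selects two disjoint teams $A,B$ (a duel) and, under deterministic feedback (winning probabilities in $\{0,1\}$), learns whether $A\succ B$ or $B\succ A$. A team $A$ is a Condorcet winning team if $A\succ B$ for all teams $B$ with $A\cap B=\emptyset$.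
   Formalization: The factor log(k) is read as log(max(k,2)): for k ≥ 2 nothing changes, while for k = 1 the literal bound would be O(1) duels, which is false because finding the best of n players needs n−1 duels. *)

(* Defs.v *)
From HB Require Import structures.
From mathcomp Require Import all_boot all_order all_algebra.
From mathcomp Require Import all_classical all_reals all_analysis.

Set Implicit Arguments.
Unset Strict Implicit.
Unset Printing Implicit Defensive.

Import Order.TTheory GRing.Theory Num.Theory.
Local Open Scope ring_scope.

Definition team (n k : nat) := {A : {set 'I_n} | #|A| == k}.

(* In all the predicates below, [succ A B] reads "A beats B". *)

Definition strict_total_order (n k : nat) (succ : rel (team n k)) : Prop :=
  [/\ irreflexive succ, transitive succ
    & forall A B : team n k, A != B -> succ A B || succ B A].

(* [S :|: {a}] is a [k]-set when [S] avoids [a] and has [k - 1] elements, but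
   not by typing: the two teams are introduced as [A] and [B]. *)
Definition always_preferred (n k : nat) (succ : rel (team n k))
    (a b : 'I_n) : Prop :=
  forall (S : {set 'I_n}) (A B : team n k),
    a \notin S -> b \notin S -> #|S| = (k - 1)%N ->
    val A = a |: S -> val B = b |: S -> succ A B.

Definition consistent (n k : nat) (succ : rel (team n k)) : Prop :=
  forall a b : 'I_n, a != b ->
    always_preferred succ a b \/ always_preferred succ b a.

Definition additive_order (R : realType) (n k : nat)
    (succ : rel (team n k)) : Prop :=
  exists v : 'I_n -> R, forall A B : team n k,
    succ A B <-> \sum_(a in val A) v a > \sum_(b in val B) v b.

Definition condorcet_winning (n k : nat) (succ : rel (team n k))
    (A : team n k) : Prop :=
  forall B : team n k, [disjoint val A & val B] -> succ A B.

(* An adaptive deterministic learner is a decision tree: [Duel dAB win lose]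
   plays A against B, then continues with [win] if A beats B and with [lose]
   if B beats A. The tree may depend on [n] and [k], but sees the order only
   through the outcomes of the duels. *)
Inductive algorithm (n k : nat) : Type :=
| Output of team n k
| Duel (A B : team n k) of [disjoint val A & val B]
    & algorithm n k & algorithm n k.

Fixpoint output (n k : nat) (alg : algorithm n k) (succ : rel (team n k)) :
    team n k :=
  match alg with
  | Output A => A
  | Duel A B _ win lose =>
      if succ A B then output win succ else output lose succ
  end.

Fixpoint num_duels (n k : nat) (alg : algorithm n k)
    (succ : rel (team n k)) : nat :=
  match alg with
  | Output _ => 0
  | Duel A B _ win lose =>
      (if succ A B then num_duels win succ else num_duels lose succ).+1
  end.

(* k n log k + k^5. The logarithm is taken at [maxn k 2]: this is [ln k] for
   all k >= 2, and keeps the term of order [n] at k = 1, where [ln k] vanishes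
   although a best player cannot be found in O(1) duels. *)
Definition duel_rate (R : realType) (n k : nat) : R :=
  k%:R * n%:R * ln (maxn k 2)%:R + k%:R ^+ 5.

(* Main.v *)
Require Import Defs.
From HB Require Import structures.
From mathcomp Require Import all_boot all_order all_algebra.
From mathcomp Require Import all_classical all_reals all_analysis.
From mathcomp Require Import fingroup perm fintype finset zify ring lra.

Set Implicit Arguments.
Unset Strict Implicit.
Unset Printing Implicit Defensive.

Import Order.TTheory GRing.Theory Num.Theory.
Local Open Scope ring_scope.

(* All that a learner knows is the set [P] of the values [v] compatible with the
   answers so far; it knows that [x] is better than [y] when [v y < v x] for all
   [v] in [P].

   Reduction to O(k) players. Exchange the players of two disjoint teams pair by
   pair until they have traded places: at some pair [(a, b)] the winner changes,
   so that [v a - v b] exceeds the difference [d] of the two rests. Any third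
   player is then proved worse than [a] or better than [b] by at most two duels.
   Hence, among a multiple of [k] players, either [b] is dominated by 2k others
   and can be dropped, or [a] dominates a positive fraction of them; after O(k)
   rounds of O(k) duels some [k] players out of [96 k] are dominated by 2k others.

   End game. Call tiers the connected components of the graph of incomparable
   pairs: tiers are totally ordered by what is known, and any permutation of a
   tier is a product of transpositions of incomparable players. If such a
   permutation changes the outcome of a duel, then one of these transpositions
   does, and this compares two new players at the cost of O(k^2) duels. This
   happens O(k^2) times, so O(k^3) duels may be spent on each new comparison.

   Suppose that these duels reveal nothing. List the players by decreasing tiers
   as [p 0, p 1, ...], let [T = p[u, 2k + e)] be the tier of [p (2k - 1)] and
   [t = min (e, 2k - u)]. Then [A = p[0, k)] is a winning team:
   - [A], with its first [t] players replaced by those at [2k, ..., 2k + t - 1],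
     beats [B = p[k, 2k)];
   - for [x] in [B] and [y] beyond [B], both in [T], and for [s < t], the sum of
     two won duels, obtained from each other by exchanging tied players, is
     [v y - v x < v (p s) - v (p (u - 1)) < v (p s) - v (p (2k + s))];
   - a best reply to [A] differs from [B] by at most [t] such exchanges [x -> y],
     so the gain over [B] is compensated by the [t] differences in the first item. *)

(** * Counting and summation tools *)

Lemma exists_subset_card (T : finType) (A : {set T}) (m : nat) :
  (m <= #|A|)%N -> exists2 B : {set T}, B \subset A & #|B| = m.
Proof.
elim: m => [|m IHm] lemA; first by exists set0; rewrite ?sub0set ?cards0.
have [B sBA cardB] := IHm (ltnW lemA).
have /set0Pn[x] : A :\: B != set0.
  by rewrite setD_eq0; apply: contraL lemA => /subset_leq_card; lia.
rewrite inE => /andP[xB xA]; exists (x |: B).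
  by rewrite subUset sub1set xA.
by rewrite cardsU1 xB cardB.
Qed.

(** Count related pairs by their second member: a [z] with at least [m] related elements accounts
    for at most [#|E|] pairs, any other for at most [m]. *)
Lemma double_counting (T : finType) (r : rel T) (E Q : {set T}) (m : nat) :
  (\sum_(a in E) #|[set z in Q | r a z]| <=
     #|[set z in Q | (m <= #|[set a | r a z]|)%N]| * #|E| + #|Q| * m)%N.
Proof.
have cardE (A : {set T}) (p : pred T) :
    #|[set z in A | p z]| = (\sum_(z in A) p z)%N.
  rewrite -sum1_card -big_mkcondr /=.
  by apply: eq_bigl => z; rewrite inE.
under eq_bigr do rewrite cardE.
rewrite exchange_big /= cardE big_distrl -sum_nat_const -big_split /=.
apply: leq_sum => z zQ; rewrite -cardE.
case: (leqP m #|[set a | r a z]|) => [_|/ltnW lem]; rewrite ?mul1n ?mul0n.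
  apply: leq_trans (leq_addr _ _); apply: subset_leq_card.
  by apply/fintype.subsetP => a; rewrite inE => /andP[].
apply: leq_trans lem; apply: subset_leq_card.
by apply/fintype.subsetP => a; rewrite !inE => /andP[].
Qed.

Lemma min_on (R : realFieldType) (w : nat -> R) (m p : nat) : (m < p)%N ->
  exists2 i0, (m <= i0 < p)%N & forall i, (m <= i < p)%N -> w i0 <= w i.
Proof.
elim: p => // p IHp; rewrite ltnS leq_eqVlt => /predU1P[<-|ltmp].
  by exists m; [lia|move=> i lei; have -> : i = m by lia].
have [i0 lei0 min0] := IHp ltmp.
have [le0p|ltp0] := leP (w i0) (w p).
  exists i0 => [|i lei]; first lia.
  have [->//|nip] := eqVneq i p; apply: min0; lia.
exists p => [|i lei]; first lia.
have [->//|nip] := eqVneq i p; apply: le_trans (ltW ltp0) (min0 i _); lia.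
Qed.

Lemma max_on (R : realFieldType) (w : nat -> R) (m p : nat) : (m < p)%N ->
  exists2 i0, (m <= i0 < p)%N & forall i, (m <= i < p)%N -> w i <= w i0.
Proof.
move=> /(min_on (fun i => - w i))[i0 lei0 min0]; exists i0 => // i /min0.
by rewrite lerN2.
Qed.

(* The positions of a best reply to [0, k) lie in [k, 2k + e), [b] is its
   indicator, and [k, 2k) is the expected reply. At most [minn e (2 * k - u)]
   positions differ, and each difference gains at most one of the [D s]. *)
Lemma exchange_bound (R : realFieldType) (k u e : nat) (w D : nat -> R) (b : nat -> bool) :
  (u < 2 * k)%N -> (\sum_(k <= i < 2 * k + e) b i = k)%N ->
  (forall s, (s < minn e (2 * k - u))%N -> 0 <= D s) ->
  (forall i j, (i < u)%N -> (u <= j < 2 * k + e)%N -> w j <= w i) ->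
  (forall s i j, (s < minn e (2 * k - u))%N -> (k <= i < 2 * k)%N -> (u <= i)%N ->
     (2 * k <= j < 2 * k + e)%N -> w j - w i <= D s) ->
  \sum_(k <= i < 2 * k + e) (b i)%:R * w i - \sum_(k <= i < 2 * k) w i <=
    \sum_(0 <= s < minn e (2 * k - u)) D s.
Proof.
move=> ltu card_b D_ge0 wU gap; have le_k : (k <= 2 * k)%N by lia.
(* As [b] selects exactly [k] positions, all weights may be measured from a common level [c]; the
   gain splits into positions given up and positions taken. *)
have splitE c : \sum_(k <= i < 2 * k + e) (b i)%:R * w i - \sum_(k <= i < 2 * k) w i =
    \sum_(k <= i < 2 * k) (1 - (b i)%:R) * (c - w i) +
    \sum_(2 * k <= i < 2 * k + e) (b i)%:R * (w i - c).
  have kR : \sum_(k <= i < 2 * k) (b i)%:R + \sum_(2 * k <= i < 2 * k + e) (b i)%:R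
      = k%:R :> R.
    by rewrite -(big_cat_nat le_k (leq_addr _ _)) -natr_sum card_b.
  have kR' : \sum_(k <= i < 2 * k) (1 : R) = k%:R.
    by rewrite big_const_nat iter_addr_0; congr _%:R; lia.
  rewrite (big_cat_nat le_k (leq_addr _ _)) /=.
  have -> : \sum_(k <= i < 2 * k) (1 - (b i)%:R) * (c - w i) =
      c * \sum_(k <= i < 2 * k) 1 - c * \sum_(k <= i < 2 * k) (b i)%:R
      - \sum_(k <= i < 2 * k) w i + \sum_(k <= i < 2 * k) (b i)%:R * w i.
    rewrite !big_distrr -!sumrB -big_split /=; apply: eq_bigr => i _; ring.
  have -> : \sum_(2 * k <= i < 2 * k + e) (b i)%:R * (w i - c) =
      \sum_(2 * k <= i < 2 * k + e) (b i)%:R * w i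
      - c * \sum_(2 * k <= i < 2 * k + e) (b i)%:R.
    rewrite big_distrr -!sumrB /=; apply: eq_bigr => i _; ring.
  by rewrite kR'; rewrite -kR; ring.
(* At the level of the least weight of the reply, giving up gains nothing, and each of the [e]
   positions taken is charged to its own [D s]. At the level of the largest weight beyond the reply,
   taking gains nothing, and [D (i - u)] pays for giving up [i]. *)
have [le_e|lt_e] := leqP e (2 * k - u).
  have [i0 i0B min0] : exists2 i0, (k <= i0 < 2 * k)%N &
      forall i, (k <= i < 2 * k)%N -> w i0 <= w i by apply: min_on; lia.
  rewrite (splitE (w i0)) -[leRHS]add0r; apply: lerD.
    rewrite big_nat; apply: sumr_le0 => i /min0 le0.
    by apply: mulr_ge0_le0; [case: (b i) => /=; lra|lra].
  rewrite -{1}[(2 * k)%N]add0n big_addn.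
  have -> : (2 * k + e - 2 * k = e)%N by lia.
  rewrite !big_nat; apply: ler_sum => s /andP[_ lts].
  have lts' : (s < minn e (2 * k - u))%N by lia.
  have D0 := D_ge0 s lts'; case: (b _); rewrite ?mul0r // mul1r.
  have [lei|lti] := leqP u i0; first by apply: gap => //; lia.
  by apply: le_trans D0; rewrite subr_le0; apply: wU => //; lia.
have [j0 j0C max0] : exists2 j0, (2 * k <= j0 < 2 * k + e)%N &
    forall j, (2 * k <= j < 2 * k + e)%N -> w j <= w j0 by apply: max_on; lia.
rewrite (splitE (w j0)) -[leRHS]addr0; apply: lerD; last first.
  rewrite big_nat; apply: sumr_le0 => j /max0 le0.
  by apply: mulr_ge0_le0; [case: (b j) => /=; lra|lra].
pose D' i := if (u <= i)%N then D (i - u)%N else 0.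
have D'_ge0 i : (i < 2 * k)%N -> 0 <= D' i.
  by rewrite /D'; case: (leqP u i) => // lei lti; apply: D_ge0; lia.
apply: le_trans (_ : \sum_(k <= i < 2 * k) D' i <= _).
  rewrite !big_nat; apply: ler_sum => i iB.
  have D0 : 0 <= D' i by apply: D'_ge0; lia.
  case: (b i); rewrite /= ?subrr ?mul0r // subr0 mul1r.
  rewrite /D' in D0 *; case: (leqP u i) D0 => [lei _|lti _].
    by apply: gap => //; lia.
  by rewrite subr_le0; apply: wU => //; lia.
apply: le_trans (_ : \sum_(0 <= i < 2 * k) D' i <= _).
  rewrite [leRHS](big_cat_nat (leq0n k) le_k) /=.
  rewrite lerDr big_nat; apply: sumr_ge0 => i ik; apply: D'_ge0; lia.
rewrite (big_cat_nat (leq0n u) (ltnW ltu)) /=.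
rewrite [X in X + _]big_nat big1 ?add0r => [|i]; last first.
  by rewrite /D'; case: (leqP u i) => //; lia.
rewrite -{1}[u]add0n big_addn !big_nat; apply: ler_sum => s /andP[_ lts].
by rewrite /D' leq_addl addnK.
Qed.

Lemma pair_ind (T : Type) (p : seq T -> Prop) : p [::] -> (forall x, p [:: x]) ->
  (forall x y s, p s -> p [:: x, y & s]) -> forall s, p s.
Proof.
move=> p0 p1 p2 s; have [m] := ubnP (size s); elim: m s => // m IHm [|x [|y s]] //= lts.
by apply/p2/IHm; lia.
Qed.

Lemma tier_arith (k u e T : nat) : (0 < k)%N -> (u < 2 * k)%N -> (T < 2 * k)%N ->
  (u + T = 2 * k + e)%N ->
  [/\ (e < u)%N, (minn e (2 * k - u) <= k)%N, (minn e (2 * k - u) <= e)%N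
    & (u <= 2 * k - minn e (2 * k - u))%N].
Proof. by move=> *; split; lia. Qed.

(** A row has four distinguished players, [h] fillers from above the tier and [q] from the tier. As
    [h] is the largest even number below [2k - T], the fillers can be paired off, the tier has
    enough of them, and room is left for [s]. *)
Lemma row_arith (k u e T s i j : nat) (h := ((2 * k - T).-1./2.*2)%N)
    (q := (2 * k - 4 - h)%N) :
  (T < 2 * k)%N -> (u + T = 2 * k + e)%N -> (e < u)%N ->
  (s < e)%N -> (u <= k + i)%N -> (i < k)%N -> (j < e)%N ->
  [/\ ~~ odd h, (s < u.-1 - h)%N, (u.-1 - h + h = u.-1)%N, (4 + h + q = 2 * k)%N
    & ~~ odd q] /\ (q <= T.-1.-1)%N.
Proof. by rewrite /q /h => *; do 2?split; lia. Qed.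

(** * States of knowledge, and duels as lists of pairs *)

Section DuelingTeams.
Context (R : realFieldType) (n k : nat).
Hypotheses (k_gt0 : (0 < k)%N) (le_2k_n : (2 * k <= n)%N).

Implicit Types (succ : rel (team n k)) (v : 'I_n -> R) (P : ('I_n -> R) -> Prop).
Implicit Types (x y z a b : 'I_n) (A B E M Q X : {set 'I_n}) (N : nat).

Definition strength v A : R := \sum_(a in A) v a.

(** The second clause is totality of the order: a duel that is not won is lost by a nonzero
    margin. *)
Definition represents v succ : Prop :=
  (forall A B : team n k, succ A B <-> strength v (val B) < strength v (val A)) /\
  (forall A B : team n k, A != B -> strength v (val A) != strength v (val B)).

Definition solvable P N : Prop :=
  exists alg : algorithm n k, forall succ v, represents v succ -> P v ->
    condorcet_winning succ (output alg succ) /\ (num_duels alg succ <= N)%N.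

(* A duel is encoded by pairing the players of its two teams arbitrarily. *)
Definition lineup := seq ('I_n * 'I_n).
Implicit Types (L : lineup).

Definition flip L : lineup := [seq (cd.2, cd.1) | cd <- L].
Definition players L : seq 'I_n := unzip1 L ++ unzip2 L.
Definition is_duel L : bool := (size L == k) && uniq (players L).
Definition margin v L : R := \sum_(cd <- L) (v cd.1 - v cd.2).

Arguments players L : simpl never.
Arguments margin v L : simpl never.

Lemma margin_nil v : margin v [::] = 0.
Proof. exact: big_nil. Qed.

Lemma margin_cons v cd L : margin v (cd :: L) = v cd.1 - v cd.2 + margin v L.
Proof. exact: big_cons. Qed.

Lemma margin_cat v L L' : margin v (L ++ L') = margin v L + margin v L'.
Proof. exact: big_cat. Qed.

Lemma margin_perm v L L' : perm_eq L L' -> margin v L = margin v L'.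
Proof. exact: perm_big. Qed.

Lemma margin_flip v L : margin v (flip L) = - margin v L.
Proof.
elim: L => [|cd L IHL]; first by rewrite margin_nil oppr0.
by rewrite /= !margin_cons IHL opprD opprB.
Qed.

Definition marginE := (margin_nil, margin_cons, margin_cat, margin_flip).

Lemma flipK : involutive flip.
Proof. by move=> L; rewrite /flip -map_comp map_id_in // => -[]. Qed.

Lemma count_players p L :
  count p (players L) = count (fun cd => p cd.1) L + count (fun cd => p cd.2) L :> nat.
Proof. by rewrite count_cat !count_map. Qed.

Lemma players_perm L L' : perm_eq L L' -> perm_eq (players L) (players L').
Proof. by move=> pL; rewrite perm_cat // perm_map. Qed.

Lemma is_duel_perm L L' :
  size L = size L' -> perm_eq (players L) (players L') -> is_duel L = is_duel L'.
Proof. by move=> sL /perm_uniq uL; rewrite /is_duel sL uL. Qed.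

Lemma players_flip L : perm_eq (players (flip L)) (players L).
Proof.
apply/seq.permP => p; rewrite !count_players /flip !count_map [RHS]addnC.
by congr (_ + _)%N; apply: eq_count.
Qed.

Lemma is_duel_flip L : is_duel (flip L) = is_duel L.
Proof. by apply: is_duel_perm (players_flip L); rewrite size_map. Qed.

Lemma players_cat L L' : perm_eq (players (L ++ L')) (players L ++ players L').
Proof. by apply/seq.permP => p; rewrite [RHS]count_cat !count_players !count_cat; lia. Qed.

Lemma players_cons cd L :
  perm_eq (players (cd :: L)) (cd.1 :: cd.2 :: players L).
Proof. apply/seq.permP => p; rewrite -[_ :: _ :: _]/([:: cd.1; cd.2] ++ players L).
by rewrite [RHS]count_cat !count_players /=; lia. Qed.

Lemma solve_weaken P P' N N' : (forall v, P v -> P' v) -> (N' <= N)%N ->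
  solvable P' N' -> solvable P N.
Proof.
move=> PP' leN [alg H]; exists alg => succ v rv Pv.
by have [cw le] := H succ v rv (PP' v Pv); split=> //; apply: leq_trans leN.
Qed.

Lemma solve_output P N A : #|A| = k ->
  (forall v, P v -> forall B, #|B| = k -> [disjoint A & B] ->
     strength v B < strength v A) ->
  solvable P N.
Proof.
move=> /eqP cardA win; exists (Output (exist _ A cardA)) => succ v [sv _] Pv.
split=> //= B dAB; apply/sv/win => //; exact/eqP/(valP B).
Qed.

Lemma solve_vacuous P N : (forall v, ~ P v) -> solvable P N.
Proof.
move=> nP; have [|A _ cardA] := @exists_subset_card _ [set: 'I_n] k.
  by rewrite cardsT card_ord; lia.
by apply: solve_output cardA _ => v /nP.
Qed.

Lemma strength_seq v (s : seq 'I_n) : uniq s -> strength v [set x in s] = \sum_(x <- s) v x.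
Proof.
move=> us; rewrite /strength big_uniq //=.
by apply: eq_bigl => x; rewrite inE.
Qed.

Lemma strength_margin v L : uniq (players L) ->
  strength v [set x in unzip1 L] - strength v [set x in unzip2 L] = margin v L.
Proof.
rewrite cat_uniq => /and3P[u1 _ u2].
by rewrite !strength_seq // !big_map -sumrB.
Qed.

Lemma solve_duel P N L : is_duel L ->
  solvable (fun v => P v /\ 0 < margin v L) N ->
  solvable (fun v => P v /\ margin v L < 0) N ->
  solvable P N.+1.
Proof.
move=> /andP[/eqP sizeL uL] [win Hwin] [lose Hlose].
have := uL; rewrite cat_uniq => /and3P[u1 /hasPn d12 u2].
have card1 : #|[set x in unzip1 L]| == k.
  by rewrite cardsE (card_uniqP u1) size_map sizeL.
have card2 : #|[set x in unzip2 L]| == k.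
  by rewrite cardsE (card_uniqP u2) size_map sizeL.
pose A : team n k := exist (fun A : {set 'I_n} => #|A| == k) _ card1.
pose B : team n k := exist (fun A : {set 'I_n} => #|A| == k) _ card2.
have dAB : [disjoint val A & val B].
  rewrite disjoint_sym disjoints_subset; apply/fintype.subsetP => x.
  by rewrite !inE => /d12.
have nAB : A != B.
  apply/eqP => eAB; move: dAB; rewrite -eAB -setI_eq0 setIid => /eqP A0.
  have : #|val A| = k by exact/eqP/(valP A).
  by rewrite A0 cards0; lia.
exists (Duel dAB win lose) => succ v rv Pv; have [sv tv] := rv.
have mE := strength_margin v uL.
have := tv _ _ nAB; rewrite -[strength v (val A) == _]subr_eq0 /= mE => m0.
case: ifP => sAB.
  suff Pv' : P v /\ 0 < margin v L by have [] := Hwin succ v rv Pv'.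
  by split=> //; rewrite -mE subr_gt0; apply/(sv A B).
suff Pv' : P v /\ margin v L < 0 by have [] := Hlose succ v rv Pv'.
split=> //; rewrite lt_neqAle m0 /= leNgt -mE subr_gt0.
by apply/negP => /(sv A B); rewrite sAB.
Qed.

(** The questions of [s] are put in turn, at [c] duels each, and [f] records the answers. [P0] and
    [N0] are the knowledge and the budget guaranteed at each question, which may be abandoned for
    another way to finish. *)
Lemma solve_each P0 (T : eqType) (Q : T -> bool -> ('I_n -> R) -> Prop) (s : seq T)
    (c : nat) N0 P N :
  uniq s -> (N0 <= N)%N -> (forall v, P v -> P0 v) ->
  (forall t P' N', t \in s -> (N0 <= N')%N -> (forall v, P' v -> P0 v) ->
     (forall b : bool, solvable (fun v => P' v /\ Q t b v) N') ->
     solvable P' (N' + c)) ->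
  (forall f : T -> bool,
     solvable (fun v => P v /\ forall t, t \in s -> Q t (f t) v) N) ->
  solvable P (N + c * size s).
Proof.
elim: s P => [|t s IHs] P us leN PP0 Hs cont.
  by rewrite muln0 addn0; apply: solve_weaken (cont xpredT).
move: us => /= /andP[ts us]; rewrite mulnS addnCA addnC.
apply: (Hs t) => //; first exact: mem_head.
  exact: leq_trans (leq_addr _ _).
move=> b; apply: IHs => //; first by move=> v [/PP0].
  by move=> t' P' N' t's; apply: Hs; rewrite inE t's orbT.
move=> f; apply: solve_weaken (cont (fun t' => if t' == t then b else f t')) => //.
move=> v [[Pv Qt] Qs]; split=> // t'; rewrite inE.
by case: eqP => [->|_] //= /Qs.
Qed.

(** * Reduction to O(k) players *)

Definition knows P x y : Prop := forall v, P v -> v y < v x.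

Lemma knows_weaken P P' x y : (forall v, P' v -> P v) -> knows P x y -> knows P' x y.
Proof. by move=> P'P K v /P'P /K. Qed.

(* Reversing the pairs of [F ++ G] one at a time reverses the sign of the margin
   at some pair [(c, d)], which is then larger than the margin of the others. *)
Lemma solve_uncover_aux P N F G : is_duel (F ++ G) ->
  (forall v, P v -> 0 < margin v (F ++ G) /\ margin v (F ++ flip G) < 0) ->
  (forall P' a b L, (forall v, P' v -> P v) -> is_duel ((a, b) :: L) ->
     {subset players ((a, b) :: L) <= players (F ++ G)} ->
     (forall v, P' v -> `|margin v L| < v a - v b) -> solvable P' N) ->
  solvable P (N + size G).
Proof.
elim: G F P => [|[c d] G IHG] F P dL sgn cont.
  by apply: solve_vacuous => v /sgn []; rewrite /= => /lt_trans/[apply]; rewrite ltxx.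
have pE e : perm_eq (F ++ e :: G) (e :: F ++ G).
  by rewrite -cat1s perm_catCA.
have plE : perm_eq (players ((d, c) :: F ++ G)) (players (F ++ (c, d) :: G)).
  rewrite perm_sym (perm_trans (players_perm (pE _))) //.
  rewrite perm_sym (perm_trans (players_cons _ _)) // perm_sym.
  rewrite (perm_trans (players_cons _ _)) //=.
  rewrite -(cat1s c) -(cat1s d) -[X in perm_eq _ X]cat1s.
  by rewrite -[X in perm_eq _ (_ ++ X)]cat1s perm_catCA.
have dL' : is_duel ((d, c) :: F ++ G).
  by rewrite (is_duel_perm _ plE) // (perm_size (pE (c, d))).
rewrite addnS; apply: (solve_duel dL').
  apply: (IHG ((d, c) :: F)) => // [v [Pv m0]|P' a b L P'P dabL subL].
    split=> //; have [_] := sgn v Pv.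
    by rewrite /= !marginE /=; lra.
  apply: cont => // [v /P'P[]//|x /subL].
  by rewrite (perm_mem plE).
apply: (solve_weaken (fun v Pv => Pv) (leq_addr _ _)).
apply: (cont _ c d (F ++ G)) => [v []//|||v [Pv]].
- by rewrite -(is_duel_perm (perm_size (pE (c, d))) (players_perm (pE (c, d)))).
- by move=> x; rewrite -(perm_mem (players_perm (pE _))).
have [+ _] := sgn v Pv.
by rewrite !marginE /= ltr_norml; lra.
Qed.

(** One duel orients the lineup, and at most [k] more reverse its pairs. *)
Lemma solve_uncover P N L : is_duel L ->
  (forall P' a b L', (forall v, P' v -> P v) -> is_duel ((a, b) :: L') ->
     {subset players ((a, b) :: L') <= players L} ->
     (forall v, P' v -> `|margin v L'| < v a - v b) -> solvable P' N) ->
  solvable P (N + k.+1).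
Proof.
move=> dL cont; have [/eqP sL _] := andP dL.
rewrite addnS; apply: (solve_duel dL).
  rewrite -sL; apply: (@solve_uncover_aux _ _ [::]) => //= [v [_]|].
    by rewrite margin_flip; lra.
  by move=> P' a b L' P'P; apply: cont => v /P'P[].
rewrite -sL -(size_map (fun cd => (cd.2, cd.1)) L) -/(flip L).
apply: (@solve_uncover_aux _ _ [::]); rewrite /= ?is_duel_flip //.
  by move=> v [_]; rewrite flipK margin_flip; lra.
move=> P' a b L' P'P dL' sub'; apply: cont => // [v /P'P[]//|x /sub'].
by rewrite (perm_mem (players_flip L)).
Qed.

Lemma margin_split z L : z \in players L ->
  exists z' L', perm_eq (players L) (z :: z' :: players L') /\ (size L = (size L').+1 /\
    ((forall v, margin v L = v z - v z' + margin v L') \/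
     (forall v, margin v L = v z' - v z + margin v L'))).
Proof.
rewrite mem_cat => /orP[] /mapP[[c d] cdL /= ->]; have pL := perm_to_rem cdL.
  exists d, (rem (c, d) L); split.
    exact: perm_trans (players_perm pL) (players_cons _ _).
  split; first by rewrite (perm_size pL).
  by left=> v; rewrite (margin_perm v pL) margin_cons.
exists c, (rem (c, d) L); split.
  apply: perm_trans (players_perm pL) _; apply: perm_trans (players_cons _ _) _.
  rewrite -cat1s -[X in perm_eq _ X]cat1s -[X in perm_eq (_ ++ X)]cat1s.
  by rewrite -[X in perm_eq _ (_ ++ X)]cat1s perm_catCA.
split; first by rewrite (perm_size pL).
by right=> v; rewrite (margin_perm v pL) margin_cons.
Qed.

(* If [z] is not in [L], the duels of [z] against [b] for [L] and for its reversal
   are decisive. If [z] is paired with [z'], the pairs [(a, z)] and [(b, z')] are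
   played against the rest [L'] of [L]. *)
Lemma solve_classify P a b L z N : is_duel ((a, b) :: L) -> z != a -> z != b ->
  (forall v, P v -> `|margin v L| < v a - v b) ->
  (forall r : bool,
     solvable (fun v => P v /\ if r then v z < v a else v b < v z) N) ->
  solvable P (N + 2).
Proof.
move=> dL za zb wit cont; rewrite addn2.
have wit2 v : P v -> margin v L < v a - v b /\ - margin v L < v a - v b.
  by move=> /wit; rewrite ltr_norml => /andP[]; lra.
have [zL|zL] := boolP (z \in players L); last first.
  have dual L' : size L' = size L -> perm_eq (players L') (players L) ->
      is_duel ((z, b) :: L').
    move: dL; rewrite /is_duel => /andP[/eqP <- u] s' p'.
    have -> : size ((z, b) :: L') == size ((a, b) :: L) by rewrite /= s'.
    rewrite (perm_uniq (players_cons _ _)) /=; move: u.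
    rewrite (perm_uniq (players_cons _ _)) /= !inE !negb_or zb.
    case/andP=> /andP[_ _] /andP[bL uL].
    by rewrite !(perm_mem p') (negPf zL) bL (perm_uniq p').
  (* Two wins add up to [v b < v z]; a single loss gives [v z < v b + |margin v L| < v a]. *)
  apply: (solve_duel (dual L _ _)) => //.
    apply: (solve_duel (dual (flip L) _ (players_flip L))); first by rewrite size_map.
      apply: solve_weaken (cont false) => // v [[Pv]].
      by rewrite !marginE /=; split=> //; lra.
    apply: solve_weaken (cont true) => // v [[Pv]].
    by have := wit2 v Pv; rewrite !marginE /=; split=> //; lra.
  apply: solve_weaken (leqnSn _) (cont true) => // v [Pv].
  by have := wit2 v Pv; rewrite !marginE /=; split=> //; lra.
have [z' [L' [pL [sL mL]]]] := margin_split zL.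
have dual L2 : size L2 = size L' -> perm_eq (players L2) (players L') ->
    is_duel [:: (a, z), (b, z') & L2].
  move=> s2 p2; rewrite (is_duel_perm _ (L' := (a, b) :: L)) //=.
    by rewrite sL s2.
  rewrite perm_sym (perm_trans (players_cons _ _)) // perm_sym.
  rewrite (perm_trans (players_cons _ _)) //= perm_cons.
  have := players_cons (b, z') L2; rewrite /= => /seq.permP p3.
  apply/seq.permP => p; move: pL => /seq.permP /(_ p); move: p2 => /seq.permP /(_ p).
  by have := p3 p; rewrite /=; lia.
apply: (solve_weaken (fun v Pv => Pv) (leqnSn _)).
(* Subtracting [margin v L] from the margin of the new duel, or adding it, leaves
   [v a + v b - 2 v z]; so a win gives [v z < v a] and a loss [v b < v z]. *)
case: mL => mL.
  apply: (solve_duel (dual L' _ _)) => //.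
    apply: solve_weaken (cont true) => // v [Pv].
    by have := wit2 v Pv; rewrite !marginE mL /=; split=> //; lra.
  apply: solve_weaken (cont false) => // v [Pv].
  by have := wit2 v Pv; rewrite !marginE mL /=; split=> //; lra.
apply: (solve_duel (dual (flip L') _ (players_flip L'))); first by rewrite size_map.
  apply: solve_weaken (cont true) => // v [Pv].
  by have := wit2 v Pv; rewrite !marginE mL /=; split=> //; lra.
apply: solve_weaken (cont false) => // v [Pv].
by have := wit2 v Pv; rewrite !marginE mL /=; split=> //; lra.
Qed.

Lemma is_duel_zip (s t : seq 'I_n) : size s = k -> size t = k -> uniq (s ++ t) ->
  is_duel (zip s t).
Proof.
move=> ss st u; rewrite /is_duel /players size_zip.
by rewrite unzip1_zip ?unzip2_zip ss st ?minnn ?eqxx.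
Qed.

Lemma exists_duel A : (2 * k <= #|A|)%N ->
  exists2 L, is_duel L & {subset players L <= A}.
Proof.
move=> leA; have [B sBA cB] := exists_subset_card leA.
have sB : size (enum B) = (2 * k)%N by rewrite -cardE.
have s1 : size (take k (enum B)) = k by rewrite size_takel // sB; lia.
have s2 : size (drop k (enum B)) = k by rewrite size_drop sB; lia.
exists (zip (take k (enum B)) (drop k (enum B))).
  by apply: is_duel_zip; rewrite ?cat_take_drop ?enum_uniq.
move=> x; rewrite /players unzip1_zip ?unzip2_zip ?s1 ?s2 // cat_take_drop.
by rewrite mem_enum; apply: (fintype.subsetP sBA).
Qed.

Lemma solve_round P A N : (2 * k <= #|A|)%N ->
  (forall P' a b, (forall v, P' v -> P v) -> a \in A -> b \in A ->
     (forall z, z \in A -> z != a -> z != b -> knows P' a z \/ knows P' z b) ->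
     solvable P' N) ->
  solvable P (N + 2 * #|A| + k.+1).
Proof.
move=> leA cont; have [L dL sLA] := exists_duel leA.
apply: (solve_uncover dL) => P' a b L' P'P dL' subL wit.
have abA x : x \in [:: a; b] -> x \in A.
  move=> xab; apply/sLA/subL; rewrite (perm_mem (players_cons _ _)) /=.
  by move: xab; rewrite !inE => /orP[] ->; rewrite ?orbT.
pose s := enum (A :\ a :\ b).
apply: (@solve_weaken _ P' _ (N + 2 * size s)) => //.
  rewrite leq_add2l leq_pmul2l // -cardE.
  by apply: subset_leq_card; apply/fintype.subsetP => x; rewrite !inE => /and3P[].
apply: (solve_each (P0 := P') (N0 := 0)
  (Q := fun z (r : bool) v => if r then v z < v a else v b < v z)) => //.
- exact: enum_uniq.
- move=> z P1 N' + _ P1P; rewrite mem_enum !inE => /and3P[zb za _].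
  by apply: (solve_classify dL') => // v /P1P /wit.
move=> f; apply: (cont _ a b) => [v []|||z zA za zb].
- by move=> /P'P.
- by apply: abA; rewrite mem_head.
- by apply: abA; rewrite !inE eqxx orbT.
have zs : z \in s by rewrite mem_enum !inE zb za.
by case fz: (f z); [left|right] => v [_ /(_ z zs)]; rewrite fz.
Qed.

Definition dominators P x : {set 'I_n} := [set y | `[<knows P y x>]].

Lemma dominators_weaken P P' x : (forall v, P' v -> P v) ->
  dominators P x \subset dominators P' x.
Proof.
move=> P'P; apply/fintype.subsetP => y; rewrite !inE => /asboolP K.
exact/asboolP/(knows_weaken P'P).
Qed.

(* [X] collects the players found to be dominated by at least [2 * k] others,
   [E] those found to dominate at least [42 * k] players of [Q]. *)
Lemma solve_batch_aux P Q X E N (m : nat) : #|Q| = (96 * k)%N ->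
  X \subset Q -> E \subset Q -> (k + 8 * k <= #|X| + #|E| + m)%N ->
  (#|X| <= k)%N -> (#|E| <= 8 * k)%N ->
  (forall x, x \in X -> (2 * k <= #|dominators P x|)%N) ->
  (forall a, a \in E -> (42 * k <= #|[set z in Q | `[<knows P a z>]]|)%N) ->
  (forall P', (forall v, P' v -> P v) ->
     (k <= #|[set x in Q | (2 * k <= #|dominators P' x|)%N]|)%N -> solvable P' N) ->
  solvable P (N + m * (194 * k)).
Proof.
move=> cQ; elim: m P X E => [|m IHm] P X E sX sE fuel leX leE domX domE cont.
  apply: (solve_weaken (fun v Pv => Pv) (leq_addr _ _)).
  apply: cont => //; apply: leq_trans (_ : #|X| <= _)%N; first by lia.
  apply: subset_leq_card; apply/fintype.subsetP => x xX.
  by rewrite inE (fintype.subsetP sX) //= domX.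
have [ltX|geX] := ltnP #|X| k; last first.
  apply: (solve_weaken (fun v Pv => Pv) (leq_addr _ _)).
  apply: cont => //; apply: leq_trans geX _.
  apply: subset_leq_card; apply/fintype.subsetP => x xX.
  by rewrite inE (fintype.subsetP sX) //= domX.
have [ltE|geE] := ltnP #|E| (8 * k)%N; last first.
  apply: (solve_weaken (fun v Pv => Pv) (leq_addr _ _)).
  apply: cont => //.
  (* Each of [8k] players dominates [42k] of the [96k] in [Q]: [336 k^2 <= 8k |G| + 192 k^2], so
     [|G| >= 18k]. *)
  pose G := [set x in Q | (2 * k <= #|dominators P x|)%N].
  have : (\sum_(a in E) #|[set z in Q | `[<knows P a z>]]| <=
          #|G| * #|E| + #|Q| * (2 * k))%N.
    exact: (double_counting (fun a z => `[<knows P a z>])).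
  have : (#|E| * (42 * k) <= \sum_(a in E) #|[set z in Q | `[<knows P a z>]]|)%N.
    by rewrite -sum_nat_const; apply: leq_sum => a /domE.
  move=> /leq_trans/[apply]; rewrite cQ -/G.
  have -> : #|E| = (8 * k)%N by apply/eqP; rewrite eqn_leq leE.
  by have := k_gt0; nia.
(* Only fresh players are used, so that each round enlarges [X] or [E]. *)
pose A := Q :\: (X :|: E).
have leA : (87 * k <= #|A|)%N.
  have := cardsD Q (X :|: E); have := cardsUI X E.
  have := subset_leq_card (subsetIr Q (X :|: E)).
  by rewrite -/A; lia.
have sAQ : A \subset Q by apply: subsetDl.
have AXE x : x \in A -> (x \notin X) /\ (x \notin E).
  by rewrite !inE negb_or => /andP[/andP[]].
clearbody A.
have leAQ : (#|A| <= 96 * k)%N by rewrite -cQ subset_leq_card.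
apply: (@solve_weaken _ P _ ((N + m * (194 * k)) + 2 * #|A| + k.+1)) => //.
  by have := k_gt0; nia.
apply: solve_round; first by lia.
move=> P' a b P'P aA bA K.
pose lo := [set z in A | `[<knows P' a z>]].
pose hi := [set z in A | `[<knows P' z b>]].
have cover : (#|A| <= #|lo| + #|hi| + 2)%N.
  have sub : A \subset (lo :|: hi) :|: [set a; b].
    apply/fintype.subsetP => z zA; rewrite !inE zA.
    have [->|za] := eqVneq z a; first by rewrite ?eqxx ?orbT.
    have [->|zb] := eqVneq z b; first by rewrite ?eqxx ?orbT.
    by have [/asboolP ->|/asboolP ->] := K z zA za zb; rewrite ?orbT.
  apply: leq_trans (subset_leq_card sub) _.
  apply: leq_trans (leq_card_setU _ _) _; apply: leq_add.
    exact: leq_card_setU.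
  by rewrite cards2; case: (_ != _).
have aQ : a \in Q := fintype.subsetP sAQ a aA.
have bQ : b \in Q := fintype.subsetP sAQ b bA.
have domX' x : x \in X -> (2 * k <= #|dominators P' x|)%N.
  by move=> /domX /leq_trans; apply; apply/subset_leq_card/dominators_weaken.
have domE' c : c \in E -> (42 * k <= #|[set z in Q | `[<knows P' c z>]]|)%N.
  move=> /domE /leq_trans; apply; apply: subset_leq_card.
  apply/fintype.subsetP => z; rewrite !inE => /andP[-> /asboolP Kz].
  exact/asboolP/(knows_weaken P'P).
have cont' P2 : (forall v, P2 v -> P' v) ->
     (k <= #|[set x in Q | (2 * k <= #|dominators P2 x|)%N]|)%N -> solvable P2 N.
  by move=> P2P'; apply: cont => v /P2P' /P'P.
(* At least [87k - 2] players are classified: either [42k] are below [a], or [44k] are above [b]. *)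
have [gelo|ltlo] := leqP (42 * k) #|lo|.
  apply: (IHm P' X (a |: E)) => //.
  - by rewrite subUset sub1set aQ.
  - by rewrite cardsU1 (AXE a aA).2; lia.
  - by rewrite cardsU1 (AXE a aA).2; lia.
  move=> c; rewrite !inE => /orP[/eqP->|/domE'//].
  apply: leq_trans gelo _; apply: subset_leq_card.
  by apply/fintype.subsetP => z; rewrite !inE => /andP[/(fintype.subsetP sAQ) -> ->].
apply: (IHm P' (b |: X) E) => //.
- by rewrite subUset sub1set bQ.
- by rewrite cardsU1 (AXE b bA).1; lia.
- by rewrite cardsU1 (AXE b bA).1; lia.
move=> x; rewrite !inE => /orP[/eqP->|/domX'//].
have : (#|hi| <= #|dominators P' b|)%N; last by lia.
apply: subset_leq_card.
by apply/fintype.subsetP => z; rewrite !inE => /andP[].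
Qed.

(** [X] and [E] together can grow [k + 8k] times, and a round on at most [96k] players costs at most
    [2 * 96k + k + 1 <= 194k] duels. *)
Lemma solve_batch P Q N : #|Q| = (96 * k)%N ->
  (forall P', (forall v, P' v -> P v) ->
     (k <= #|[set x in Q | (2 * k <= #|dominators P' x|)%N]|)%N -> solvable P' N) ->
  solvable P (N + 9 * k * (194 * k)).
Proof.
move=> cQ; apply: (@solve_batch_aux P Q set0 set0) => //;
  rewrite ?sub0set ?cards0 //; try lia; by move=> x; rewrite inE.
Qed.

(* Outside [M], no player is among the best [2 * k]: a best reply to any team
   thus lies in [M]. *)
Definition hopeless P M : Prop := forall v, P v -> forall y, y \notin M ->
  (2 * k <= #|[set x | (v y < v x)%R]|)%N.

Lemma hopeless_weaken P P' M : (forall v, P' v -> P v) -> hopeless P M -> hopeless P' M.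
Proof. by move=> P'P h v /P'P /h. Qed.

(** A batch of [1746 k^2] duels removes at least [k] players, hence [1746 k] duels per player of
    [M]. *)
Lemma solve_reduce N :
  (forall P M, hopeless P M -> (#|M| <= 96 * k)%N -> solvable P N) ->
  forall P M, hopeless P M -> solvable P (N + 1746 * k * #|M|).
Proof.
move=> cont P M; have [m] := ubnP #|M|; elim: m P M => // m IHm P M ltm hM.
have [leM|ltM] := leqP #|M| (96 * k).
  by apply: (solve_weaken (fun v Pv => Pv) (leq_addr _ _)); apply: cont hM leM.
have [Q sQ cQ] := exists_subset_card (ltnW ltM).
apply: (@solve_weaken _ P _ (N + 1746 * k * (#|M| - k) + 9 * k * (194 * k))) => //.
  by nia.
apply: (solve_batch cQ) => P' P'P; set X := [set x in Q | _] => leX.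
have cD : #|M :\: X| = (#|M| - #|X|)%N.
  rewrite cardsD; congr (_ - #|pred_of_set _|)%N; apply/setIidPr.
  by apply: fintype.subset_trans sQ; apply/fintype.subsetP => x; rewrite inE => /andP[].
apply: (@solve_weaken _ P' _ (N + 1746 * k * #|M :\: X|)) => //.
  by rewrite cD; nia.
apply: IHm; first by rewrite cD; lia.
move=> v P'v y; rewrite inE negb_and negbK => /orP[|yM]; last exact: hM (P'P v P'v) y yM.
rewrite inE => /andP[_ /leq_trans]; apply; apply: subset_leq_card.
by apply/fintype.subsetP => x; rewrite !inE => /asboolP; apply.
Qed.

(** * Tiers *)

Definition incomparable P x y : Prop := ~ knows P x y /\ ~ knows P y x.

Definition learned P M P' : Prop :=
  exists x y, [/\ x \in M, y \in M, incomparable P x y & knows P' x y].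

Definition act (s : 'I_n -> 'I_n) L : lineup := [seq (s cd.1, s cd.2) | cd <- L].

Lemma players_act s L : players (act s L) = map s (players L).
Proof. by rewrite /players /unzip1 /unzip2 map_cat -!map_comp. Qed.

Lemma is_duel_act s L : injective s -> is_duel (act s L) = is_duel L.
Proof. by move=> inj; rewrite /is_duel size_map players_act map_inj_uniq. Qed.

(** The coefficient depends on [L] alone: it counts, with signs, the occurrences of [x] and [y]. *)
Lemma margin_tperm x y L : exists c : int, forall v,
  margin v (act (tperm x y) L) = margin v L + c%:~R * (v x - v y).
Proof.
have one z : exists c : int, forall v, v (tperm x y z) = v z + c%:~R * (v x - v y).
  case: tpermP => [->|->|_ _]; [exists (-1)|exists 1|exists 0] => v;
    by rewrite ?mulrN1z ?mulr0z; lra.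
elim: L => [|[c d] L [i IHL]]; first by exists 0 => v; rewrite /= !margin_nil; lra.
have [[j Hj] [l Hl]] := (one c, one d).
exists (j - l + i) => v.
by rewrite /= !margin_cons /= IHL Hj Hl !rmorphD rmorphN /=; ring.
Qed.

(* The sign of the coefficient in [margin_tperm] tells which player is better. *)
Lemma knows_tperm P x y L :
  (forall v, P v -> margin v L < 0 /\ 0 < margin v (act (tperm x y) L)) ->
  knows P x y \/ knows P y x.
Proof.
move=> sgn; have [c mE] := margin_tperm x y L.
have [c_gt0|c_le0] := ltP 0 c; [left|right] => v /sgn[]; rewrite mE => m_lt0 m_gt0.
  rewrite -subr_gt0 -(pmulr_rgt0 _ (_ : 0 < c%:~R)) ?ltr0z //; lra.
have c_le0' : c%:~R <= 0 :> R by rewrite lerz0.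
rewrite ltNge; apply/negP => le_yx.
have : c%:~R * (v x - v y) <= 0 by rewrite mulr_le0_ge0 // subr_ge0.
lra.
Qed.

(** A walk between lineups in which the margin can rise only at exchanges of incomparable players;
    [q] bounds the number of steps, hence of duels. *)
Inductive chain P M : nat -> lineup -> lineup -> Prop :=
| ChainStop q L : chain P M q L L
| ChainSwap q L L' x y : x \in M -> y \in M -> incomparable P x y ->
    chain P M q (act (tperm x y) L) L' -> chain P M q.+1 L L'
| ChainDown q L L1 L' : is_duel L1 -> (forall v, P v -> margin v L1 <= margin v L) ->
    chain P M q L1 L' -> chain P M q.+1 L L'.

Lemma chain_leq P M q q' L L' : (q <= q')%N -> chain P M q L L' -> chain P M q' L L'.
Proof.
move=> + ch; elim: ch q' => {q L L'} [q L|q L L' x y xM yM xy _ IH|q L L1 L' d1 le1 _ IH] q'.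
- by move=> _; apply: ChainStop.
- by case: q' => // q' /IH; apply: ChainSwap.
by case: q' => // q' /IH; apply: ChainDown.
Qed.

(* The margin can only become positive at a swap of two incomparable players, and
   [knows_tperm] then compares them. *)
Lemma solve_chain P M N q L L' P' :
  (forall P', (forall v, P' v -> P v) -> learned P M P' -> solvable P' N) ->
  chain P M q L L' -> is_duel L -> (forall v, P' v -> P v) ->
  (forall v, P' v -> margin v L < 0) -> (forall v, P' v -> 0 < margin v L') ->
  solvable P' (N + q).
Proof.
move=> HL ch; elim: ch P' => {q L L'} [q L|q L L' x y xM yM xy _ IH|q L L1 L' d1 le1 _ IH] P'.
- move=> _ _ neg pos; apply: solve_vacuous => v P'v.
  by have := pos v P'v; rewrite ltNge ltW ?neg.
- move=> dL P'P neg pos; have dL1 : is_duel (act (tperm x y) L).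
    by rewrite is_duel_act //; apply: perm_inj.
  rewrite addnS; apply: (solve_duel dL1).
    apply: (solve_weaken (fun v Pv => Pv) (leq_addr _ _)).
    apply: HL => [v [/P'P]//|].
    have [v [/neg]|Kxy|Kyx] :=
      @knows_tperm (fun v => P' v /\ 0 < margin v (act (tperm x y) L)) x y L.
    + by [].
    + by exists x, y.
    + by exists y, x; split=> //; case: xy.
  by apply: IH => // v [] // /[dup] /P'P ? /pos.
move=> dL P'P neg pos; rewrite addnS; apply: (solve_duel d1).
  apply: solve_vacuous => v [P'v]; apply/negP; rewrite -leNgt.
  exact: le_trans (le1 v (P'P v P'v)) (ltW (neg v P'v)).
by apply: IH => // v [] // /[dup] /P'P ? /pos.
Qed.

Definition linked P M : rel 'I_n :=
  fun x y => [&& x \in M, y \in M & `[<incomparable P x y>]].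

(* The classes of [tied] are the tiers: they are totally ordered by [knows]. *)
Definition tied P M : rel 'I_n := connect (linked P M).

Lemma linked_sym P M : symmetric (linked P M).
Proof.
move=> x y; apply/and3P/and3P => -[? ? /asboolP[? ?]]; split=> //; exact/asboolP.
Qed.

Lemma tied_sym P M x y : tied P M x y = tied P M y x.
Proof. exact/sym_connect_sym/linked_sym. Qed.

(** Conjugation: [(x y) = (x z)(z y)(x z)] for the successor [z] of [x], so each edge of a simple
    path costs at most two exchanges. *)
Lemma chain_path P M x p q L L' : path (linked P M) x p -> uniq (x :: p) ->
  chain P M q (act (tperm x (last x p)) L) L' -> chain P M (q + 2 * size p) L L'.
Proof.
elim: p x q L L' => [|z p IHp] x q L L' /=.
  move=> _ _; rewrite tperm1 muln0 addn0; congr chain; rewrite /act map_id_in // => -[c d] _.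
  by rewrite !perm1.
move=> /andP[/and3P[xM zM /asboolP xz] pth] /andP[xzp uzp].
have [->|pN0] := eqVneq p [::].
  by move=> ch; apply: chain_leq (_ : q.+1 <= _)%N _; [rewrite /=; lia|apply: ChainSwap ch].
set y := last z p => ch.
have yzp : y \in p by case: {+}p pN0 @y {ch} => // c p' _; rewrite /= mem_last.
have xy : x != y by apply: contraNneq xzp => ->; rewrite inE yzp orbT.
have zy : z != y by move: uzp => /= /andP[+ _]; apply: contraNneq => ->.
have comp : act (tperm x y) L = act (tperm x z) (act (tperm z y) (act (tperm x z) L)).
  have conj : tperm x y = (tperm x z * tperm z y * tperm x z)%g.
    by rewrite -{1}(tpermV x z) -mulgA -conjgE tpermJ tpermR tpermD.
  rewrite /act -!map_comp; apply: eq_map => -[c d] /=.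
  by rewrite conj !permM.
have -> : (q + 2 * (size p).+1 = (q.+1 + 2 * size p).+1)%N.
  by rewrite mulnS addnA addn2 addSn.
apply: (ChainSwap xM zM xz); apply: (IHp z) => //.
by apply: (ChainSwap xM zM xz); rewrite -comp.
Qed.

Lemma chain_tied P M x y q L L' : tied P M x y ->
  chain P M q (act (tperm x y) L) L' -> chain P M (q + 2 * #|M|) L L'.
Proof.
move=> /connectP[p0 pth0 ->]; case: (shortenP pth0) => p pth u _ ch.
apply: chain_leq (chain_path pth u ch); rewrite leq_add2l leq_pmul2l //.
case/andP: u => _ /card_uniqP <-; apply: subset_leq_card; apply/fintype.subsetP.
elim: p x pth {ch p0 pth0} => // z p IHp x /= /andP[/and3P[_ zM _] pth] c.
by rewrite inE => /orP[/eqP->//|]; apply: IHp pth c.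
Qed.

Lemma act_tperm_pair F G c d : uniq (players (F ++ (c, d) :: G)) ->
  act (tperm c d) (F ++ (c, d) :: G) = F ++ (d, c) :: G.
Proof.
have pE : perm_eq (players (F ++ (c, d) :: G)) (c :: d :: players (F ++ G)).
  apply: perm_trans (players_cons (c, d) _); apply: players_perm.
  by rewrite -cat1s perm_catCA.
rewrite (perm_uniq pE) /= inE negb_or => /andP[/andP[_ cFG] /andP[dFG _]].
have fixe L : {subset L <= F ++ G} -> act (tperm c d) L = L.
  move=> sub; rewrite /act map_id_in // => -[a b] /sub abL.
  have aFG : a \in players (F ++ G) by rewrite mem_cat (map_f fst abL).
  have bFG : b \in players (F ++ G) by rewrite mem_cat (map_f snd abL) orbT.
  rewrite /= !tpermD //; apply/eqP => eq; move: cFG dFG; rewrite eq ?aFG ?bFG //.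
rewrite /act map_cat /= tpermL tpermR -!/(act _ _) !fixe // => ab; rewrite mem_cat => -> //.
exact: orbT.
Qed.

Definition above P M : rel 'I_n := fun x y => tied P M x y || `[<knows P x y>].

Definition flip_tied P M L : lineup :=
  [seq if tied P M cd.1 cd.2 then (cd.2, cd.1) else cd | cd <- L].

Lemma flip_tied_cons P M cd L : flip_tied P M (cd :: L) =
  (if tied P M cd.1 cd.2 then (cd.2, cd.1) else cd) :: flip_tied P M L.
Proof. by []. Qed.

Lemma players_flip_tied P M L : perm_eq (players (flip_tied P M L)) (players L).
Proof.
apply/seq.permP => p; rewrite !count_players.
elim: L => // -[c d] L IHL; rewrite flip_tied_cons.
by case: ifP => _ /=; lia.
Qed.

Lemma flip_tiedK P M : involutive (flip_tied P M).
Proof.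
move=> L; rewrite /flip_tied -map_comp map_id_in // => -[c d] _ /=.
by case: (boolP (tied P M c d)) => t /=; rewrite ?(negPf t) // tied_sym t.
Qed.

(** Pairs are reversed one by one: a tied pair by exchanges along a path of its tier, a pair led by
    the player known to be better by one descending step. *)
Lemma chain_map P M (h : 'I_n * 'I_n -> 'I_n * 'I_n) F G : is_duel (F ++ G) ->
  (forall cd, cd \in G -> h cd = cd \/ h cd = (cd.2, cd.1) /\ above P M cd.1 cd.2) ->
  chain P M (size G * (2 * #|M|).+1) (F ++ G) (F ++ map h G).
Proof.
elim: G F => [|[c d] G IHG] F dL hG; first exact: ChainStop.
have -> : (size ((c, d) :: G) * (2 * #|M|).+1 = size G * (2 * #|M|).+1 + (2 * #|M|).+1)%N.
  by rewrite /= mulSn addnC.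
have hG' cd : cd \in G -> h cd = cd \/ _ :=
  fun cdG => hG cd (mem_behead (s := _ :: _) cdG).
have dL' : is_duel (F ++ (d, c) :: G).
  rewrite (is_duel_perm (L' := F ++ (c, d) :: G)) ?size_cat //.
  apply: perm_trans (players_cat _ _) _; rewrite perm_sym.
  apply: perm_trans (players_cat _ _) _; rewrite perm_cat2l.
  apply: perm_trans (players_cons _ _) _; rewrite perm_sym.
  apply: perm_trans (players_cons _ _) _ => /=.
  by apply/seq.permP => p /=; lia.
rewrite [map h _]/=; have [->|[hcd cd]] := hG (c, d) (mem_head _ _).
  rewrite -!cat_rcons; apply: chain_leq (leq_addr _ _) (IHG _ _ hG').
  by rewrite cat_rcons.
have next : chain P M (size G * (2 * #|M|).+1) (F ++ (d, c) :: G) (F ++ h (c, d) :: map h G).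
  by rewrite hcd /= -!cat_rcons; apply: IHG hG'; rewrite cat_rcons.
case/orP: cd => [tcd|/asboolP kcd].
  apply: chain_leq (_ : size G * (2 * #|M|).+1 + 2 * #|M| <= _)%N _; first lia.
  apply: (chain_tied tcd); rewrite act_tperm_pair //.
  by case/andP: dL.
apply: chain_leq (_ : (size G * (2 * #|M|).+1).+1 <= _)%N _; first lia.
apply: ChainDown dL' _ next => v /kcd /=.
by rewrite !marginE /=; lra.
Qed.

(** If such a duel is lost, its reversal is won, and the walk from one to the other reveals a
    comparison. So the duel may be taken as won. *)
Lemma solve_ballot P M N N' P' L :
  (forall P', (forall v, P' v -> P v) -> learned P M P' -> solvable P' N) ->
  (forall v, P' v -> P v) -> (N + k * (2 * #|M|).+1 <= N')%N ->
  is_duel L -> all (fun cd => above P M cd.1 cd.2) L ->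
  solvable (fun v => P' v /\ 0 < margin v L) N' -> solvable P' N'.+1.
Proof.
move=> HL P'P leN dL /allP abL win; apply: (solve_duel dL) => //.
apply: (solve_weaken (fun v Pv => Pv) leN).
have -> : k = size L by case/andP: dL => /eqP.
have ch : chain P M (size L * (2 * #|M|).+1) L (flip L).
  by apply: (@chain_map _ _ _ [::]) => // cd /abL; right.
apply: (solve_chain HL ch dL) => [v [/P'P]|v []|v []] //.
by rewrite margin_flip; lra.
Qed.

(* The duel [F ++ G] and its variant where all tied pairs of [G] are reversed
   are both won, and the contributions of [G] to the two margins cancel. *)
Lemma solve_rows P M N N' P' L F G :
  (forall P', (forall v, P' v -> P v) -> learned P M P' -> solvable P' N) ->
  (forall v, P' v -> P v) -> (N + k * (2 * #|M|).+1 <= N')%N ->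
  is_duel L -> all (fun cd => above P M cd.1 cd.2) L ->
  is_duel (F ++ G) -> (forall v, margin v (F ++ G) = margin v L) ->
  (forall cd, cd \in G -> above P M cd.2 cd.1) ->
  solvable (fun v => P' v /\ 0 < margin v F) N' -> solvable P' (N' + 2).
Proof.
move=> HL P'P leN dL abL dFG mE abG win; rewrite addn2.
apply: (solve_ballot HL P'P _ dL abL); first exact: leq_trans leN (leqnSn _).
have dFG' : is_duel (F ++ flip_tied P M G).
  rewrite (is_duel_perm (L' := F ++ G)) ?size_cat ?size_map //.
  apply: perm_trans (players_cat _ _) _; rewrite perm_sym.
  apply: perm_trans (players_cat _ _) _; rewrite perm_cat2l.
  by rewrite perm_sym players_flip_tied.
apply: (solve_duel dFG').
  apply: solve_weaken win => // v [[P'v]]; rewrite -mE !margin_cat => m1 m2.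
  (* Tied pairs cancel with their reversals; any other pair of [G] is led by the worse player and
     counts negatively twice. *)
  suff : margin v G + margin v (flip_tied P M G) <= 0 by split=> //; lra.
  have Pv := P'P v P'v; elim: G {mE dFG dFG' m1 m2} abG => [|[c d] G IHG] abG.
    by rewrite /= margin_nil addr0.
  have := IHG (fun cd cdG => abG cd (mem_behead (s := _ :: _) cdG)).
  have := abG (c, d) (mem_head _ _).
  rewrite /above tied_sym flip_tied_cons !margin_cons /=.
  by case: ifP => _ /=; [lra|move=> /asboolP/(_ v Pv); lra].
(* If the variant is lost, reversing the tied pairs back leads to a duel already won. *)
have ch : chain P M (size (flip_tied P M G) * (2 * #|M|).+1)
    (F ++ flip_tied P M G) (F ++ flip_tied P M (flip_tied P M G)).
  apply: chain_map => // -[c d] _ /=.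
  by case: ifP => t; [right; rewrite /above t|left].
apply: (solve_weaken (fun v Pv => Pv) (_ : N + size (flip_tied P M G) * (2 * #|M|).+1 <= _)%N).
  apply: leq_trans leN; rewrite leq_add2l leq_pmul2r //.
  by case/andP: dFG => /eqP <- _; rewrite size_map size_cat leq_addl.
apply: (solve_chain HL ch dFG') => [v [[/P'P]]|v []|v [[]]] //.
by rewrite flip_tiedK mE.
Qed.

Lemma knows_total P M x y : x \in M -> y \in M -> ~~ tied P M x y ->
  knows P x y \/ knows P y x.
Proof.
move=> xM yM; apply: contraNP => nK; apply: connect1; rewrite /linked xM yM /=.
by apply/asboolP; split=> K; apply: nK; [left|right].
Qed.

Lemma knows_trans P x y z : knows P x y -> knows P y z -> knows P x z.
Proof. by move=> xy yz v Pv; apply: lt_trans (yz v Pv) (xy v Pv). Qed.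

(** Sort by number of dominators: when [y] is known to be better than [x], the dominators of [x]
    contain those of [y] and [y] itself. *)
Lemma pairwise_above P M A : (exists v, P v) -> A \subset M ->
  exists s, [/\ uniq s, s =i A & pairwise (above P M) s].
Proof.
move=> [v Pv] sAM; pose le x y := (#|dominators P x| <= #|dominators P y|)%N.
have le_total : total le by move=> x y; apply: leq_total.
have le_trans : transitive le by move=> x y z; apply: leq_trans.
exists (sort le (enum A)); split; first by rewrite sort_uniq enum_uniq.
  by move=> x; rewrite mem_sort mem_enum.
have := sort_sorted le_total (enum A); rewrite sorted_pairwise //.
apply: (@sub_in_pairwise _ (mem A)); last first.
  by apply/allP => x; rewrite mem_sort mem_enum.
move=> x y /(fintype.subsetP sAM) xM /(fintype.subsetP sAM) yM; apply: contraTT.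
rewrite negb_or => /andP[/(knows_total xM yM) [kxy|kyx] nkxy].
  by case/asboolP: nkxy.
rewrite -ltnNge; apply: proper_card; apply/properP; split.
  apply/fintype.subsetP => z; rewrite !inE => /asboolP kzy.
  exact/asboolP/(knows_trans kzy kyx).
exists y; first by rewrite inE; apply/asboolP.
by rewrite inE; apply/asboolP => /(_ v Pv); rewrite ltxx.
Qed.

(** Tiers compare as wholes: a [z] linked to [x] is comparable to [y], and if [y] were better than
    [z], so would be [x]. *)
Lemma knows_tiedl P M x y x' : (exists v, P v) -> x \in M -> y \in M ->
  ~~ tied P M x y -> knows P x y -> tied P M x x' -> knows P x' y.
Proof.
move=> [v Pv] xM yM nxy kxy /connectP[p pth ->].
elim: p x xM nxy kxy pth => //= z p IHp x xM nxy kxy /andP[/[dup] lxz].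
move=> /and3P[_ zM /asboolP[nkxz _]] pth; have nzy : ~~ tied P M z y.
  by apply: contraNN nxy; apply: connect_trans (connect1 lxz).
apply: IHp pth => //; case: (knows_total zM yM nzy) => // kyz.
by case: nkxz; apply: knows_trans kyz.
Qed.

Lemma knows_tiedr P M x y y' : (exists v, P v) -> x \in M -> y \in M ->
  ~~ tied P M x y -> knows P x y -> tied P M y y' -> knows P x y'.
Proof.
move=> [v Pv] xM yM nxy kxy /connectP[p pth ->].
elim: p y yM nxy kxy pth => //= z p IHp y yM nxy kxy /andP[/[dup] lyz].
move=> /and3P[_ zM /asboolP[nkyz nkzy]] pth; have nxz : ~~ tied P M x z.
  apply: contraNN nxy => /connect_trans; apply; rewrite -/(tied P M z y) tied_sym.
  exact: connect1.
apply: IHp pth => //; case: (knows_total xM zM nxz) => // kzx.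
by case: nkzy; apply: knows_trans kxy.
Qed.

Lemma hopeless_card P M : (exists v, P v) -> hopeless P M -> (2 * k <= #|M|)%N.
Proof.
move=> [v Pv] hM; have [/setP full|] := eqVneq M [set: 'I_n].
  by rewrite (eq_card (B := [set: 'I_n])) ?cardsT ?card_ord.
rewrite -subTset => /subsetPn[y0 _ y0M].
have [y yM ymax] : exists2 y, y \notin M & forall z, z \notin M -> v z <= v y.
  case: (@arg_maxP _ _ _ y0 (fun y => y \notin M) v y0M) => y yM ymax.
  by exists y.
apply: leq_trans (hM v Pv y yM) _; apply: subset_leq_card.
apply/fintype.subsetP => x; rewrite inE => lt_yx.
by apply: contraLR lt_yx => /ymax; rewrite -leNgt.
Qed.

(** [sT] is the tier of the player [t] at position [2k - 1] of the sorted list, [sU] the players of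
    [M] in higher tiers. All of [sU] precedes [t], while [t] and its predecessors lie in the union,
    hence the two bounds. A player of [M] left out is known to be worse than the whole union. *)
Lemma boundary_tier P M : (exists v, P v) -> hopeless P M ->
  exists sU sT, [/\ uniq (sU ++ sT), {subset sU ++ sT <= M},
    (size sU < 2 * k <= size (sU ++ sT))%N & pairwise (above P M) (sU ++ sT)] /\
    [/\ {in sT &, forall x y, tied P M x y},
      {in sU & sT, forall x y, knows P x y} & hopeless P [set x in sU ++ sT]].
Proof.
move=> exP hM; have leM := hopeless_card exP hM.
have [s [us sM abs]] := pairwise_above exP (subxx M).
have sizes : size s = #|M| by rewrite -(card_uniqP us); apply: eq_card.
have [s1 [t [s2 [def_s size1]]]] : exists s1 t s2,
    s = s1 ++ t :: s2 /\ size (t :: s1) = (2 * k)%N.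
  have pos2k : (0 < 2 * k)%N by rewrite muln_gt0.
  have lt : ((2 * k).-1 < size s)%N by rewrite prednK // sizes.
  have x0 : 'I_n by case: (s) lt.
  exists (take (2 * k).-1 s), (nth x0 s (2 * k).-1), (drop (2 * k).-1.+1 s).
  by rewrite -drop_nth // cat_take_drop /= size_takel ?prednK // ltnW.
have tM : t \in M by rewrite -sM def_s mem_cat mem_head orbT.
pose U := [set x in M | ~~ tied P M x t && `[<knows P x t>]].
pose T := [set x in M | tied P M x t].
have sUM : U \subset M by apply/fintype.subsetP => x; rewrite inE => /andP[].
have [sU [uU mU abU]] := pairwise_above exP sUM.
move: abs; rewrite def_s pairwise_cat /= => /and3P[ab1 _ /andP[abt _]].
have [v Pv] := exP.
have K x y : x \in U -> y \in T -> knows P x y.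
  rewrite !inE => /and3P[xM nxt /asboolP kxt] /andP[yM yt].
  by apply: (knows_tiedr exP xM tM nxt kxt); rewrite tied_sym.
have UT x : x \in U -> x \notin T.
  by rewrite !inE => /and3P[-> ->].
have sub1 x : x \in s1 -> x \in U :|: T.
  move=> x1; have xM : x \in M by rewrite -sM def_s mem_cat x1.
  have := allrelP ab1 x t x1 (mem_head _ _); rewrite !inE xM /above.
  by case: tied => //= ->; rewrite orbF.
have subU x : x \in U -> x \in s1.
  move=> xU; have := xU; rewrite !inE => /and3P[xM nxt /asboolP kxt].
  have : x \in s by rewrite sM.
  rewrite def_s mem_cat inE => /or3P[//|/eqP ext|x2].
    by move: nxt; rewrite ext /tied connect0.
  have := allP abt x x2; rewrite /above tied_sym (negPf nxt) => /asboolP ktx.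
  by have := lt_trans (ktx v Pv) (kxt v Pv); rewrite ltxx.
have ut : uniq (t :: s1).
  move: us; rewrite def_s -cat1s uniq_catCA cat1s cons_uniq mem_cat cat_uniq negb_or.
  by case/andP=> /andP[ts1 _] /andP[us1 _]; rewrite cons_uniq ts1.
have leUT : (2 * k <= #|U :|: T|)%N.
  rewrite -size1 -(card_uniqP ut); apply/subset_leq_card/fintype.subsetP => x.
  rewrite inE => /orP[/eqP->|/sub1 //].
  by rewrite !inE tM /tied connect0 orbT.
exists sU, (enum T).
have mT x : x \in enum T = (x \in T) by rewrite mem_enum.
have uw : uniq (sU ++ enum T).
  rewrite cat_uniq uU enum_uniq andbT /=; apply/hasPn => x; rewrite mT mU.
  by apply: contraL => /UT.
have sizew : size (sU ++ enum T) = #|U :|: T|.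
  rewrite -(card_uniqP uw); apply: eq_card => x.
  by rewrite mem_cat mU mT in_setU.
do 2?split => //.
- move=> x; rewrite mem_cat mU mT !inE => /orP[/andP[]|/andP[]] //.
- rewrite sizew leUT andbT -(card_uniqP uU) (eq_card mU) -size1 /= ltnS.
  have us1 : uniq s1 by case/andP: ut.
  by rewrite -(card_uniqP us1); apply/subset_leq_card/fintype.subsetP.
- rewrite pairwise_cat abU /=; apply/andP; split.
    apply/allrelP => x y; rewrite mU mT => xU yT.
    by apply/orP; right; apply/asboolP/K.
  apply/(pairwiseP t) => i j; rewrite !inE => lti ltj _.
  have := mem_nth t lti; have := mem_nth t ltj; rewrite !mT !inE => /andP[_ tj] /andP[_ ti].
  by rewrite /above /tied (connect_trans ti) // -/(tied _ _ _ _) tied_sym.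
- move=> x y; rewrite !mT !inE => /andP[_ tx] /andP[_ ty].
  by rewrite /tied (connect_trans tx) // -/(tied _ _ _ _) tied_sym.
- by move=> x y; rewrite mU mT; apply: K.
move=> v' Pv' y; rewrite inE mem_cat mU mT => yUT.
have [yM|yM] := boolP (y \in M); last exact: hM.
have nyt : ~~ tied P M y t.
  by apply: contraNN yUT => yt; rewrite !inE yM yt orbT.
have kty : knows P t y.
  case: (knows_total yM tM nyt) => // kyt; case/negP: yUT.
  by rewrite !inE yM nyt (_ : `[<knows P y t>]) //; apply/asboolP.
apply: leq_trans leUT _; apply/subset_leq_card/fintype.subsetP => x.
rewrite in_setU => /orP[xU|].
  have tT : t \in T by rewrite inE tM /tied connect0.
  by rewrite inE; apply: lt_trans (kty v' Pv') (K x t xU tT v' Pv').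
rewrite inE => /andP[xM xt]; rewrite inE; apply: (knows_tiedl exP tM yM _ kty _ Pv').
  by rewrite tied_sym.
by rewrite tied_sym.
Qed.

(** * Certifying a winning team *)

Fixpoint couples (s : seq 'I_n) : lineup :=
  if s is x :: y :: s' then (x, y) :: couples s' else [::].

Lemma size_couples s : size (couples s) = (size s)./2.
Proof. by elim/pair_ind: s => //= x y s ->. Qed.

Lemma players_couples s : ~~ odd (size s) -> perm_eq (players (couples s)) s.
Proof.
elim/pair_ind: s => //= x y s IHs; rewrite negbK => /IHs ps.
by apply: perm_trans (players_cons _ _) _; rewrite /= !perm_cons.
Qed.

Lemma all_couples (r : rel 'I_n) s : pairwise r s -> all (fun cd => r cd.1 cd.2) (couples s).
Proof. by elim/pair_ind: s => //= x y s IHs /and3P[/andP[-> _] _ /IHs]. Qed.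

(** In this alternating sum, [a] in front shifts the pairing of [s] by one and so reverses its
    signs. *)
Lemma margin_couples_shift v a s z : ~~ odd (size s) ->
  margin v (couples (a :: rcons s z)) = v a - v z - margin v (couples s).
Proof.
elim/pair_ind: s a => [|//|x y s IHs] a; first by rewrite /= !marginE; lra.
by rewrite [odd _]/= negbK => /IHs IH; rewrite /= !margin_cons IH /=; lra.
Qed.

(** Paired consecutively, [a :: rcons s z] has no pair led by a lower tier. Paired as [(a, z)] and
    the reversed couples of [s], the same teams isolate [(x, y)] and [(a, z)] as the [F] of
    [solve_rows]. *)
Lemma solve_tier_row P M N N' P' a s z x y ts :
  (forall P', (forall v, P' v -> P v) -> learned P M P' -> solvable P' N) ->
  (forall v, P' v -> P v) -> (N + k * (2 * #|M|).+1 <= N')%N ->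
  uniq ([:: x, y & a :: rcons s z] ++ ts) ->
  ~~ odd (size s) -> ~~ odd (size ts) -> (4 + size s + size ts = 2 * k)%N ->
  pairwise (above P M) (a :: rcons s z) -> tied P M x y -> pairwise (tied P M) ts ->
  solvable (fun v => P' v /\ v y - v x < v a - v z) N' -> solvable P' (N' + 2).
Proof.
move=> HL P'P leN uw es ets sizes abw xy tts win.
have evw : ~~ odd (size (a :: rcons s z)) by rewrite /= size_rcons /= negbK.
pose L := (x, y) :: couples (a :: rcons s z) ++ couples ts.
pose F := [:: (x, y); (a, z)]; pose G := flip (couples s) ++ couples ts.
have pL : perm_eq (players L) ([:: x, y & a :: rcons s z] ++ ts).
  apply: perm_trans (players_cons _ _) _; rewrite /= !perm_cons.
  apply: perm_trans (players_cat _ _) _; rewrite -cat_cons.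
  by apply: perm_cat; apply: players_couples.
have dL : is_duel L.
  rewrite /is_duel (perm_uniq pL) uw andbT /L -cat1s !size_cat !size_couples.
  rewrite [size (_ :: rcons _ _)]/= size_rcons; apply/eqP => /=.
  by move: es ets sizes; clear; lia.
have pFG : perm_eq (players (F ++ G)) (players L).
  apply: perm_trans (_ : perm_eq _ [:: x, y, a & rcons s z ++ ts]) _; last first.
    by rewrite perm_sym.
  apply: perm_trans (players_cons (x, y) ((a, z) :: G)) _; rewrite 2!perm_cons.
  apply: perm_trans (players_cons (a, z) G) _; rewrite perm_cons.
  rewrite -cats1 -catA perm_sym perm_catCA perm_cons perm_sym.
  apply: perm_trans (players_cat _ _) _; apply: perm_cat; last exact: players_couples.
  by apply: perm_trans (players_flip _) _; apply: players_couples.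
apply: (solve_rows (L := L) (F := F) (G := G) HL P'P leN dL).
- have abv : pairwise (above P M) ts.
    by apply: sub_pairwise tts => c d; rewrite /above => ->.
  by rewrite /L -cat1s !all_cat !all_couples // /= /above xy.
- rewrite (is_duel_perm _ pFG) // /F /G /L -[X in _ = size X]cat1s !size_cat.
  rewrite size_map !size_couples [size (_ :: rcons _ _)]/= size_rcons /=.
  by move: es; clear; lia.
- move=> v; rewrite /F /G /L /= !margin_cons !margin_cat margin_flip.
  by rewrite margin_couples_shift //=; lra.
- have /allP abs : all (fun cd => above P M cd.1 cd.2) (couples s).
    apply: all_couples; apply: subseq_pairwise abw.
    apply: (subseq_trans (subseq_rcons s z)); exact: subseq_cons.
  have /allP tied_ts := all_couples tts.
  move=> [c d]; rewrite /G mem_cat => /orP[/mapP[[c' d'] /abs ab' [-> ->]] //|/tied_ts /=].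
  by rewrite /above tied_sym => ->.
apply: solve_weaken win => // v [P'v]; rewrite /F !marginE /=; split=> //; lra.
Qed.

Lemma sum_seq_nth (x0 : 'I_n) (s : seq 'I_n) (p : pred 'I_n) (F : 'I_n -> R) :
  \sum_(x <- s | p x) F x = \sum_(0 <= i < size s) (p (nth x0 s i))%:R * F (nth x0 s i).
Proof.
rewrite (big_nth x0) big_mkcond /=; apply: eq_bigr => i _.
by case: ifP; rewrite ?mul1r ?mul0r.
Qed.

(** If the best [B] contained [y] outside [W], one of the [2k] players better than [y] would avoid
    the [2k - 1] other members of [A] and [B], and could replace [y]. *)
Lemma best_reply v A (W : {set 'I_n}) : #|A| = k -> (exists B, #|B| = k /\ [disjoint A & B]) ->
  (forall y, y \notin W -> (2 * k <= #|[set x | (v y < v x)%R]|)%N) ->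
  exists B, [/\ #|B| = k, [disjoint A & B], B \subset W &
    forall B', #|B'| = k -> [disjoint A & B'] -> strength v B' <= strength v B].
Proof.
move=> cA [B0 [cB0 dB0]] hW.
have PB0 : (#|B0| == k) && [disjoint A & B0] by rewrite cB0 eqxx.
case: (@arg_maxP _ _ _ B0 (fun B : {set 'I_n} => (#|B| == k) && [disjoint A & B])
  (strength v) PB0) => B /andP[/eqP cB dB] maxB.
exists B; split=> // [|B' cB' dB']; last by apply: maxB; rewrite cB' eqxx.
apply/fintype.subsetP => y yB; apply/negPn/negP => yW.
have : ~~ ([set x | (v y < v x)%R] \subset (A :|: B) :\ y).
  apply/negP => /subset_leq_card; apply/negP; rewrite -ltnNge.
  apply: leq_trans (hW y yW); have : (#|A :|: B| <= #|A| + #|B|)%N := leq_card_setU A B.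
  by rewrite (cardsD1 y (A :|: B)) inE yB orbT cA cB addnn -mul2n.
case/subsetPn => z; rewrite !inE => lt_yz.
have -> /= : z != y by apply: contraTneq lt_yz => ->; rewrite ltxx.
rewrite negb_or => /andP[zA zB].
have yzB : z \notin B :\ y by rewrite !inE (negPf zB) andbF.
have /maxB : (#|z |: B :\ y| == k) && [disjoint A & z |: B :\ y].
  rewrite cardsU1 yzB -cB (cardsD1 y B) yB eqxx /= disjoint_sym.
  rewrite disjoints_subset; apply/fintype.subsetP => x; rewrite !inE.
  case/orP=> [/eqP->//|/andP[_ xB]]; apply: contraL xB => xA.
  by rewrite (disjointFr dB).
rewrite /strength big_setU1 //= (big_setD1 y yB) /= leNgt.
by rewrite ltrD2r lt_yz.
Qed.

(** The last premise on [v] is the opening margin. By [exchange_bound], it pays for all that a best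
    reply gains over the positions [[k, 2k)]. *)
Lemma certificate v (w : seq 'I_n) (u e : nat) (x0 : 'I_n) (p := nth x0 w)
    (t := minn e (2 * k - u)) :
  uniq w -> size w = (2 * k + e)%N -> (u < 2 * k)%N -> (e <= u)%N ->
  (forall y, y \notin w -> (2 * k <= #|[set x | (v y < v x)%R]|)%N) ->
  (forall i j, (i < u)%N -> (u <= j < 2 * k + e)%N -> v (p j) < v (p i)) ->
  (forall s i j, (s < t)%N -> (k <= i < 2 * k)%N -> (u <= i)%N ->
     (2 * k <= j < 2 * k + e)%N -> v (p j) - v (p i) <= v (p s) - v (p (2 * k + s)%N)) ->
  0 < \sum_(0 <= i < k) v (p i) - \sum_(k <= i < 2 * k) v (p i)
      - \sum_(0 <= s < t) (v (p s) - v (p (2 * k + s)%N)) ->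
  forall B, #|B| = k -> [disjoint [set x in take k w] & B] ->
    strength v B < strength v [set x in take k w].
Proof.
move=> uw sw ltu leeu hW wU gap row B cB dB.
have utk : uniq (take k w) by apply: take_uniq.
have stk : size (take k w) = k by rewrite size_takel // sw; lia.
have cA : #|[set x in take k w]| = k by rewrite cardsE (card_uniqP utk).
have [||B' [cB' dB' sB' maxB']] := @best_reply v [set x in take k w] [set x in w] cA.
- by exists B.
- by move=> y; rewrite inE; apply: hW.
apply: le_lt_trans (maxB' B cB dB) _.
pose b i := p i \in B'.
have b0 i : (i < k)%N -> b i = false.
  move=> ltik; apply: (disjointFr dB'); rewrite inE /p -(nth_take (n0 := k)) //.
  by apply: mem_nth; rewrite stk.
have sumB (F : 'I_n -> R) : \sum_(x in B') F x = \sum_(k <= i < 2 * k + e) (b i)%:R * F (p i).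
  have -> : \sum_(x in B') F x = \sum_(x <- w | x \in B') F x.
    rewrite -big_filter -[RHS]big_filter; apply: perm_big; apply: uniq_perm.
    - by rewrite filter_uniq // index_enum_uniq.
    - by rewrite filter_uniq.
    move=> x; rewrite !mem_filter mem_index_enum andbT.
    by case: (boolP (x \in B')) => //= /(fintype.subsetP sB'); rewrite inE => ->.
  rewrite (sum_seq_nth x0) sw (big_cat_nat (n := k)) //=; last by lia.
  rewrite [X in X + _]big_nat big1 ?add0r // => i /b0; rewrite /b /p => ->.
  by rewrite mul0r.
have card_b : (\sum_(k <= i < 2 * k + e) b i = k)%N.
  apply/eqP; rewrite -(eqr_nat R) natr_sum -[X in _ == X%:R]cB' -sum1_card natr_sum.
  by rewrite (sumB (fun _ => 1%:R)); apply/eqP; apply: eq_bigr => i _; rewrite mulr1.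
have D_ge0 s : (s < t)%N -> 0 <= v (p s) - v (p (2 * k + s)%N).
  by move=> lts; rewrite subr_ge0 ltW // wU //; move: lts; rewrite /t; lia.
have := exchange_bound ltu card_b D_ge0 (fun i j iu ju => ltW (wU i j iu ju)) gap.
rewrite {1}/strength sumB strength_seq // (sum_seq_nth x0 _ xpredT) stk.
have -> : \sum_(0 <= i < k) true%:R * v (nth x0 (take k w) i) = \sum_(0 <= i < k) v (p i).
  by rewrite !big_nat; apply: eq_bigr => i /andP[_ ltik]; rewrite mul1r nth_take.
move: row; rewrite -/t; lra.
Qed.

Section OpeningDuel.
Context (w : seq 'I_n) (e t : nat) (x0 : 'I_n).
Hypotheses (uw : uniq w) (sw : size w = (2 * k + e)%N).
Hypotheses (le_tk : (t <= k)%N) (le_te : (t <= e)%N).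
Let p := nth x0 w.

(* The duel of the positions [0, k) against [k, 2k), with the best [t] players
   of the first team replaced by those at the positions [2k, 2k + t). *)
Definition opening : lineup :=
  [seq (p (i + t)%N, p (i + k)%N) | i <- iota 0 (k - t)] ++
  [seq (p (i + 2 * k)%N, p (i + (2 * k - t))%N) | i <- iota 0 t].

Lemma is_duel_opening : is_duel opening.
Proof.
have unzip1_map (f g : nat -> 'I_n) r : unzip1 [seq (f i, g i) | i <- r] = map f r.
  by rewrite /unzip1 -map_comp.
have unzip2_map (f g : nat -> 'I_n) r : unzip2 [seq (f i, g i) | i <- r] = map g r.
  by rewrite /unzip2 -map_comp.
have mapE m q : [seq p (i + m)%N | i <- iota 0 q] = map p (iota m q).
  by rewrite -[in RHS](addn0 m) iotaDl -map_comp; apply: eq_map => i /=; rewrite addnC.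
rewrite /is_duel size_cat !size_map !size_iota subnK // eqxx /=.
pose I := iota t (k - t) ++ iota (2 * k) t ++ iota k (k - t) ++ iota (2 * k - t) t.
have -> : players opening = map p I.
  rewrite /players /opening [unzip1 _]map_cat [unzip2 _]map_cat.
  rewrite -/(unzip1 _) -/(unzip1 [seq _ | i <- iota 0 t]) !unzip1_map.
  rewrite -/(unzip2 _) -/(unzip2 [seq _ | i <- iota 0 t]) !unzip2_map.
  by rewrite !mapE -!map_cat -catA.
rewrite map_inj_in_uniq => [|i j].
  rewrite /I !cat_uniq !iota_uniq /= !andbT; apply/and3P.
  have k0 := k_gt0; split; apply/hasPn => i; rewrite ?mem_cat !mem_iota;
    by move: le_tk le_te k0; clear; lia.
have ltI l : l \in I -> (l < size w)%N.
  by rewrite sw /I !mem_cat !mem_iota; move: le_tk le_te; clear; lia.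
by move=> /ltI lti /ltI ltj /eqP; rewrite nth_uniq // => /eqP.
Qed.

Lemma margin_opening v : margin v opening =
  \sum_(0 <= i < k) v (p i) - \sum_(k <= i < 2 * k) v (p i)
  - \sum_(0 <= s < t) (v (p s) - v (p (2 * k + s)%N)).
Proof.
have iotaE q : iota 0 q = index_iota 0 q by rewrite /index_iota subn0.
rewrite /margin /opening (iotaE (k - t)%N) (iotaE t) big_cat !big_map /= !sumrB.
have shiftE (F : nat -> R) m q : \sum_(m <= i < q) F i = \sum_(0 <= i < q - m) F (i + m)%N.
  by rewrite -{1}[m]add0n big_addn.
have [le1 le2] : (k <= 2 * k - t)%N /\ (2 * k - t <= 2 * k)%N.
  by move: le_tk; clear; lia.
have [eq1 eq2] : (2 * k - t - k = k - t)%N /\ (2 * k - (2 * k - t) = t)%N.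
  by move: le_tk; clear; lia.
rewrite (big_cat_nat (leq0n t) le_tk) (big_cat_nat le1 le2) /=.
rewrite (shiftE _ t k) (shiftE _ k (2 * k - t)%N) (shiftE _ (2 * k - t)%N (2 * k)%N) eq1 eq2.
have -> : \sum_(0 <= i < t) v (p (2 * k + i)%N) = \sum_(0 <= i < t) v (p (i + 2 * k)%N).
  by apply: eq_bigr => i _; rewrite addnC.
by ring.
Qed.

(** Pairs of the first group have increasing positions, the group being empty when [t = k]; the
    second group lies inside the tier. *)
Lemma all_opening (r : rel 'I_n) (u : nat) :
  (forall i j, (i < j)%N -> (j < 2 * k + e)%N -> r (p i) (p j)) ->
  (forall i j, (u <= i < 2 * k + e)%N -> (u <= j < 2 * k + e)%N -> r (p i) (p j)) ->
  (u <= 2 * k - t)%N -> all (fun cd => r cd.1 cd.2) opening.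
Proof.
move=> r_lt r_tier leu; rewrite /opening all_cat !all_map; apply/andP; split.
  apply/allP => i; rewrite mem_iota => ilt; have k0 := k_gt0.
  have [ltk|lek] := ltnP t k.
    by apply: r_lt; move: ilt le_tk ltk; clear; lia.
  by move: ilt lek; clear; lia.
apply/allP => i; rewrite mem_iota => ilt.
by apply: r_tier; move: ilt leu le_tk le_te; clear; lia.
Qed.

End OpeningDuel.

(** There are at most [k * k * #|M|] rows of two duels each, and one opening duel. The cost of a
    walk is paid at most once, as a walk ends with a new comparison. *)
Lemma solve_step P M N : hopeless P M ->
  (forall P', (forall v, P' v -> P v) -> learned P M P' -> solvable P' N) ->
  solvable P (N + k * (2 * #|M|).+1 + 2 * (k * k * #|M|) + 1).
Proof.
move=> hM HL; have [exP|nP] := pselect (exists v, P v); last first.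
  by apply: solve_vacuous => v Pv; apply: nP; exists v.
have [sU [sT [[uw wM /andP[ltu leT] abw] [tT KUT hw]]]] := boundary_tier exP hM.
set w := sU ++ sT in uw wM leT abw hw.
pose u := size sU; pose e := (size w - 2 * k)%N.
have sw : size w = (2 * k + e)%N by rewrite subnKC.
have sw' : size w = (u + size sT)%N by rewrite size_cat.
have leM : (size w <= #|M|)%N.
  by rewrite -(card_uniqP uw); apply/subset_leq_card/fintype.subsetP.
(* In a duel inside the tier all pairs are tied: whoever wins, the walk to the reversal reveals a
   comparison. *)
have [geT|ltT] := leqP (2 * k) (size sT).
  have uT : uniq sT by move: uw; rewrite cat_uniq => /and3P[].
  have [|L dL subL] := @exists_duel [set x in sT].
    by rewrite cardsE (card_uniqP uT).
  have tied_pair cd : cd \in L -> tied P M cd.1 cd.2.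
    move=> cdL; apply: tT.
      by have := subL cd.1; rewrite inE; apply; rewrite mem_cat map_f.
    by have := subL cd.2; rewrite inE; apply; rewrite mem_cat (map_f snd) ?orbT.
  have chainL L' : is_duel L' -> {in L', forall cd, tied P M cd.1 cd.2} ->
      chain P M (k * (2 * #|M|).+1) L' (flip L').
    move=> dL' tL'; have := dL' => /andP[/eqP sL' _]; rewrite -{1}sL'.
    by apply: (@chain_map _ _ _ [::]) => // cd /tL' t; right; rewrite /above t.
  rewrite addn1.
  apply: (solve_weaken (fun v Pv => Pv) (_ : (N + k * (2 * #|M|).+1).+1 <= _)%N).
    by rewrite ltnS leq_addr.
  apply: (solve_duel dL).
    have dfL : is_duel (flip L) by rewrite is_duel_flip.
    apply: (solve_chain HL (chainL _ dfL _) dfL) =>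
      [[c d] /mapP[[c' d'] cdL [-> ->]]|v []|v []|v []] //.
    - by rewrite tied_sym; apply: tied_pair cdL.
    - by rewrite margin_flip; lra.
    - by rewrite flipK.
  apply: (solve_chain HL (chainL _ dL tied_pair) dL) => [v []|v []|v []] //.
  by rewrite margin_flip; lra.
have [x0 _] : exists x0, x0 \in w.
  by case: (w) sw => [|x0 ? _]; [move=> /= ?; have := k_gt0; lia|exists x0; exact: mem_head].
pose p := nth x0 w; pose t := minn e (2 * k - u).
have arith : [/\ (e < u)%N, (t <= k)%N, (t <= e)%N & (u <= 2 * k - t)%N].
  by apply: tier_arith k_gt0 ltu ltT _; rewrite -sw' sw.
have [lteu le_tk le_te le_ut] := arith.
have p_in i : (i < size w)%N -> p i \in w by apply: mem_nth.
have pU i : (i < u)%N -> p i \in sU.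
  by move=> lti; rewrite /p /w nth_cat -/u lti mem_nth.
have pT i : (u <= i < size w)%N -> p i \in sT.
  by move=> /andP[lei lti]; rewrite /p /w nth_cat -/u ltnNge lei mem_nth // ltn_subLR // -sw'.
have p_lt i j : (i < j)%N -> (j < size w)%N -> above P M (p i) (p j).
  move=> ltij ltj; apply: (pairwiseP x0 abw) => //; rewrite inE //.
  exact: ltn_trans ltj.
have p_tier i j : (u <= i < size w)%N -> (u <= j < size w)%N -> tied P M (p i) (p j).
  by move=> iT jT; apply: tT; apply: pT.
have p_inj i j : (i < size w)%N -> (j < size w)%N -> p i = p j -> i = j.
  by move=> lti ltj /eqP; rewrite nth_uniq // => /eqP.
rewrite addn1; apply: (solve_ballot (L := opening w t x0) HL) => //.
- by rewrite leq_addr.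
- exact: is_duel_opening sw _ _.
- apply: (@all_opening w e t x0 _ _ _ u) => // i j; rewrite -sw; first exact: p_lt.
  by move=> iT jT; rewrite /above p_tier.
(* A row is given by [s < t], a position [k + i] of the reply inside the tier, and a position
   [2k + j] beyond the reply. *)
pose rows := [seq r : 'I_t * 'I_k * 'I_e <- enum {: 'I_t * 'I_k * 'I_e} | (u <= k + r.1.2)%N].
(* Both answers record the same bound, since a lost row yields a comparison instead. *)
pose row_bound (r : 'I_t * 'I_k * 'I_e) (_ : bool) v :=
  v (p (2 * k + r.2)%N) - v (p (k + r.1.2)%N) < v (p r.1.1) - v (p u.-1).
apply: (solve_weaken (fun v Pv => Pv) (_ : N + k * (2 * #|M|).+1 + 2 * size rows <= _)%N).
  rewrite leq_add2l leq_pmul2l // size_filter.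
  apply: leq_trans (count_size _ _) _.
  rewrite -cardE !card_prod !card_ord; apply: leq_mul; first exact: leq_mul.
  by apply: leq_trans leM; rewrite sw leq_addl.
apply: (solve_each (P0 := P) (N0 := N + k * (2 * #|M|).+1) (Q := row_bound)) => //.
- by rewrite filter_uniq // enum_uniq.
- by move=> v [].
- move=> [[s i] j] P' N' + leN P'P cont; rewrite mem_filter /= => /andP[leui _].
  pose h := ((2 * k - size sT).-1./2.*2)%N; pose q := (2 * k - 4 - h)%N.
  (* The fillers are the [h] positions just before [u - 1], and [q] positions of the tier other than
     [k + i] and [2k + j]. *)
  pose sI := iota (u.-1 - h) h.
  pose tI := take q (rem (2 * k + j)%N (rem (k + i)%N (iota u (size sT)))).
  have [[lts lti] ltj] := (ltn_ord s, ltn_ord i, ltn_ord j).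
  have uTe : (u + size sT = 2 * k + e)%N by rewrite -sw' sw.
  have [[odd_h lt_sh hE hq odd_q] leqT] :=
    row_arith ltT uTe lteu (leq_trans lts le_te) leui lti ltj.
  rewrite -/h -/q in odd_h lt_sh hE hq odd_q leqT.
  have ltiw : (u <= k + i < size w)%N by rewrite leui sw; move: lti; clear; lia.
  have ltjw : (u <= 2 * k + j < size w)%N.
    by rewrite sw ltn_add2l ltj andbT; apply: leq_trans (ltnW ltu) (leq_addr _ _).
  have ltuw : (u <= size w)%N by rewrite sw' leq_addr.
  have tIP l : l \in tI -> [/\ (u <= l < size w)%N, l != (k + i)%N & l != (2 * k + j)%N].
    move=> /mem_take; rewrite mem_rem_uniq ?rem_uniq ?iota_uniq // inE /=.
    by rewrite mem_rem_uniq ?iota_uniq // !inE mem_iota -sw' => /and3P[-> -> ->].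
  have size_tI : size tI = q.
    have inI : (k + i)%N \in iota u (size sT) by rewrite mem_iota -sw'.
    have inR : (2 * k + j)%N \in rem (k + i)%N (iota u (size sT)).
      rewrite mem_rem_uniq ?iota_uniq // !inE mem_iota -sw' ltjw andbT.
      by move: lti; clear; lia.
    by rewrite size_takel // (size_rem inR) (size_rem inI) size_iota.
  have [Z [sIE uZ mZ ltZ]] : exists Z, [/\ rcons (map p sI) (p u.-1) = map p Z, uniq Z,
      forall l, l \in Z -> (u.-1 - h <= l < u)%N & pairwise ltn (nat_of_ord s :: Z)].
    exists (iota (u.-1 - h) h.+1); split.
    - by rewrite -addn1 iotaD hE map_cat cats1.
    - exact: iota_uniq.
    - by move=> l; rewrite mem_iota addnS hE; move: lteu; clear; lia.
    rewrite -(sorted_pairwise ltn_trans) /= lt_sh /=.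
    exact: (iota_ltn_sorted (u.-1 - h) h.+1).
  have ltsw : (s < size w)%N by move: lt_sh ltuw; clear; lia.
  have ltZw l : l \in Z -> (l < size w)%N.
    by move=> /mZ /andP[_ ltlu]; apply: leq_trans ltlu ltuw.
  apply: (solve_tier_row (a := p s) (s := map p sI) (z := p u.-1) (x := p (k + i)%N)
    (y := p (2 * k + j)%N) (ts := map p tI) HL P'P leN) (cont true).
  - pose I := [:: (k + i)%N, (2 * k + j)%N, nat_of_ord s & Z].
    rewrite sIE -[X in uniq X]/(map p I ++ map p tI) -map_cat map_inj_in_uniq.
      rewrite cat_uniq take_uniq ?rem_uniq ?iota_uniq // andbT; apply/andP; split.
        rewrite /I !cons_uniq uZ !inE !negb_or andbT.
        have notZ l : ~~ (u.-1 - h <= l < u)%N -> l \notin Z by apply: contraNN => /mZ.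
        rewrite !notZ; move: lt_sh hE lti ltj leui ltu lteu; rewrite -/u; clear; lia.
      apply/hasPn => l /tIP[lT li lj]; rewrite /I !inE (negPf li) (negPf lj) /=.
      rewrite negb_or; apply/andP; split; first by move: lt_sh lT; clear; lia.
      by apply: contraTN lT => /mZ; clear; lia.
    have ltl l : l \in I ++ tI -> (l < size w)%N.
      rewrite mem_cat /I !inE => /orP[/or4P[/eqP->|/eqP->|/eqP->|/ltZw]|/tIP[]] //.
      - by case/andP: ltiw.
      - by case/andP: ltjw.
      by case/andP.
    by move=> l l' /ltl ltl1 /ltl ltl2; apply: p_inj.
  - by rewrite size_map size_iota.
  - by rewrite size_map size_tI.
  - by rewrite !size_map size_iota size_tI.
  - rewrite sIE -map_cons pairwise_map.
    apply: (@sub_in_pairwise _ (fun l => l < size w)%N ltn) ltZ => [l l' _ ltl' ltll'|].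
      exact: p_lt.
    by apply/allP => l; rewrite inE => /orP[/eqP->//|/ltZw].
  - exact: p_tier.
  rewrite pairwise_map; apply/(pairwiseP 0%N) => a b; rewrite !inE => lta ltb _.
  by apply: p_tier; [have [] := tIP _ (mem_nth 0%N lta)|have [] := tIP _ (mem_nth 0%N ltb)].
move=> f; have sw2k : (2 * k <= size w)%N by rewrite sw leq_addr.
have stk : size (take k w) = k by rewrite size_takel //; lia.
apply: (@solve_output _ _ [set x in take k w]).
  by rewrite cardsE (card_uniqP _) ?take_uniq.
move=> v [[Pv m0] rowsP]; apply: (@certificate v w u e x0) => //.
- exact: ltnW.
- by move=> y yw; apply: (hw v Pv); rewrite inE.
- move=> i j iu ju; apply: (KUT (p i) (p j)) => //; [exact: pU|].
  by apply: pT; rewrite sw.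
- move=> s i j lts /andP[lei lti] leui /andP[lej ltj].
  have lti' : (i - k < k)%N by lia.
  have ltj' : (j - 2 * k < e)%N by lia.
  pose r : 'I_t * 'I_k * 'I_e := (Ordinal lts, Ordinal lti', Ordinal ltj').
  have rin : r \in rows by rewrite mem_filter mem_enum /= subnKC // leui.
  have := rowsP r rin; rewrite /row_bound /= !subnKC // => /ltW /le_trans; apply.
  (* [p (2k + s)] is in the tier, hence worse than [p (u - 1)]. *)
  rewrite lerD2l lerN2; apply/ltW/(KUT (p u.-1)) => //.
    by apply: pU; rewrite ltn_predL; apply: leq_ltn_trans lteu.
  apply: pT; rewrite sw ltn_add2l (leq_trans lts le_te) andbT.
  exact: leq_trans (ltnW ltu) (leq_addr _ _).
by move: m0; rewrite margin_opening.
Qed.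

(** * Counting the comparisons still open *)

Definition open_pairs P M : {set 'I_n * 'I_n} :=
  [set xy in setX M M | `[<incomparable P xy.1 xy.2>]].

Lemma learned_open_pairs P M P' : (forall v, P' v -> P v) -> learned P M P' ->
  (#|open_pairs P' M| < #|open_pairs P M|)%N.
Proof.
move=> P'P [x [y [xM yM xy Kxy]]]; apply: proper_card; apply/properP; split.
  apply/fintype.subsetP => -[z z']; rewrite !inE => /andP[-> /asboolP[nK nK']].
  by apply/asboolP; split=> K; [apply: nK|apply: nK']; apply: knows_weaken K.
exists (x, y); first by rewrite !inE xM yM; apply/asboolP.
by rewrite !inE xM yM /=; apply/asboolP => -[].
Qed.

(** Each step finishes or closes an open pair, so there is at most one more step than open pairs. *)
Lemma solve_open_pairs P M (c := (k * (2 * #|M|).+1 + 2 * (k * k * #|M|) + 1)%N) :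
  hopeless P M -> solvable P (#|open_pairs P M|.+1 * c).
Proof.
have [m] := ubnP #|open_pairs P M|; elim: m P => // m IHm P ltm hM.
apply: (@solve_weaken _ P _ (#|open_pairs P M| * c + c)) => //.
  by rewrite mulSn addnC.
rewrite {2}/c addnA addnA; apply: solve_step => // P' P'P lP'.
have lt' := learned_open_pairs P'P lP'.
apply: (@solve_weaken _ P' _ (#|open_pairs P' M|.+1 * c)) => //.
  by rewrite leq_mul2r lt' orbT.
by apply: IHm (hopeless_weaken P'P hM); apply: leq_trans lt' _.
Qed.

Lemma solvable_all : solvable (fun _ => True) (97 ^ 2 * 386 * k ^ 5 + 1746 * k * n).
Proof.
set N := (97 ^ 2 * 386 * k ^ 5)%N.
suff small P M : hopeless P M -> (#|M| <= 96 * k)%N -> solvable P N.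
  have := solve_reduce small (P := fun _ => True) (M := [set: 'I_n]).
  by rewrite cardsT card_ord; apply=> v _ y; rewrite inE.
move=> hM leM; apply: solve_weaken (solve_open_pairs hM) => //.
have : (#|open_pairs P M| <= #|M| * #|M|)%N.
  rewrite -cardsX; apply/subset_leq_card/fintype.subsetP => xy.
  by rewrite inE => /andP[].
move: #|open_pairs P M| #|M| k_gt0 leM => o m k0 lem leo.
have le1 : (o.+1 <= 97 ^ 2 * k ^ 2)%N.
  have lt_m : (m < 97 * k)%N by move: k0 lem; clear; lia.
  by rewrite -expnMn; apply: leq_ltn_trans leo _; apply: ltn_mul.
(* The three terms are at most [193 k^2], [192 k^3] and [1]. *)
have le2 : (k * (2 * m).+1 + 2 * (k * k * m) + 1 <= 386 * k ^ 3)%N.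
  have K_gt0 : (0 < k * k * k)%N by rewrite !muln_gt0 k0.
  have le_k2 : (k * k <= k * k * k)%N by rewrite leq_pmulr.
  have le_lin : (k * (2 * m).+1 <= 193 * (k * k))%N.
    by rewrite mulnCA leq_mul2l; move: k0 lem; clear; lia.
  have le_quad : (k * k * m <= 96 * (k * k * k))%N.
    by rewrite mulnCA leq_mul2l lem orbT.
  rewrite !expnS expn0 muln1 mulnA.
  move: (k * k * k)%N (k * k * m)%N (k * (2 * m).+1)%N (k * k)%N
    K_gt0 le_k2 le_lin le_quad.
  by clear; lia.
apply: leq_trans (leq_mul le1 le2) _.
have prodE (c d : nat) : (c * k ^ 2 * (d * k ^ 3) = c * d * k ^ 5)%N by rewrite mulnACA -expnD.
by rewrite prodE leqnn.
Qed.

End DuelingTeams.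

(** * From additive orders and the duel count to the stated rate *)

Lemma represents_additive (R : realType) (n k : nat) (succ : rel (team n k)) :
  strict_total_order succ -> additive_order R succ ->
  exists v : 'I_n -> R, represents v succ.
Proof.
move=> [irr _ tot] [v sv]; exists v; split=> // A B /tot sAB.
apply/negP => /eqP; rewrite /strength => eAB.
by case/orP: sAB => /sv; rewrite eAB ltxx.
Qed.

(** The count obtained has no logarithm; the factor [l / l2 >= 1], with [l = ln (maxn k 2)] and
    [l2 = ln 2], introduces it into the term [kn]. *)
Lemma rate_bound (R : realFieldType) (c d kn K l l2 : R) :
  0 <= c -> 0 <= d -> 0 <= kn -> 0 <= K -> 0 < l2 -> 1 <= l / l2 ->
  c * K + d * kn <= (d / l2 + c) * (kn * l + K).
Proof.
move=> c0 d0 kn0 K0 l20 le_l.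
have l0 : 0 <= l by rewrite -(pmulr_lge0 _ (_ : 0 < l2^-1)) ?invr_gt0 // (le_trans ler01).
have -> : (d / l2 + c) * (kn * l + K) =
    c * K + (d * kn * (l / l2) + (d / l2 * K + c * kn * l)) by ring.
rewrite lerD2l; apply: le_trans (_ : d * kn * (l / l2) <= _).
  by rewrite ler_peMr // mulr_ge0.
by rewrite lerDl addr_ge0 ?mulr_ge0 // invr_ge0 ltW.
Qed.

Theorem theorem7 (R : realType) :
  exists C : R, forall n k : nat, (1 <= k)%N -> (2 * k <= n)%N ->
    exists alg : algorithm n k, forall succ : rel (team n k),
      strict_total_order succ -> consistent succ -> additive_order R succ ->
      condorcet_winning succ (output alg succ) /\
      (num_duels alg succ)%:R <= C * duel_rate R n k.
Proof.
have [c [d solve]] : exists c d, forall n k, (0 < k)%N -> (2 * k <= n)%N ->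
    solvable k (fun _ : 'I_n -> R => True) (c * k ^ 5 + d * k * n).
  by exists (97 ^ 2 * 386)%N, 1746%N; apply: solvable_all.
exists (d%:R / ln 2 + c%:R) => n k k_gt0 le_2k_n.
have [alg algP] := solve n k k_gt0 le_2k_n.
exists alg => succ sto _ add; have [v rv] := represents_additive sto add.
have [win le_duels] := algP succ v rv I; split=> //.
have ln2_gt0 : 0 < ln 2 :> R by rewrite ln_gt0 // ltr1n.
have le_ln : 1 <= ln (maxn k 2)%:R / ln 2 :> R.
  by rewrite ler_pdivlMr // mul1r ler_ln ?posrE ?ltr0n ?ler_nat ?leq_max ?leqnn ?orbT.
move: le_duels; rewrite -(ler_nat R) => /le_trans; apply.
rewrite /duel_rate natrD natrM natrX -mulnA !natrM.
by apply: rate_bound; rewrite ?mulr_ge0 ?exprn_ge0 ?ler0n.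
Qed.
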